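(* (i) The assignment $(D,k)\mapsto t_k(D)$ is a bijection from the set of pairs $(D,k)$ with $D>1$ a square-free integer and $k\geq1$ an integer onto $\mathbb{Z}_{\geq3}$. Consequently, for every fixed $m\geq3$, the map $(D,k)\mapsto\Psi_m(t_k(D))$ on such pairs is injective. Its set of values contains every integer $N\geq\Psi_m(3)$ if and only if $m\in\{3,4,6\}$; for every other $m\geq3$ the values form an infinite set of (natural) density zero. (ii) For every fixed square-free $D>1$ and all $n,k\geq1$, $$t_{nk}-2=(t_k-2)(t_k+2)^{\mathbf{1}_{2\mid n}}\prod_{\substack{m\mid n\\ m\geq3}}\Psi_m(t_k)^2,$$ where $\mathbf{1}_{2\mid n}$ is $1$ if $n$ is even and $0$ if $n$ is odd. (iii) Fix a square-free $D>1$. Let $m\geq3$ and let $p$ be a prime with $p\nmid 2mD$. Then $\rho_m(p)<\infty$ if and only if $m\mid o(p)$, in which case $\rho_m(p)=o(p)/m$. Moreover, in that case, for $k\geq1$, $p\mid\Psi_m(t_k)$ if and only if $k=\rho_m(p)\,l$ for some integer $l\geq1$ coprime to $m$; and at every such occurrence $v_p(\Psi_m(t_k))=a_p+v_p(l)$. (iv) For every fixed square-free $D>1$ and every integer $n>12$ there is a prime $p\nmid 2D$ with $o(p)=n$.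
   Context: For a square-free integer $D>1$ let $K=\mathbb{Q}(\sqrt D)$ with ring of integers $\mathcal{O}_K$, let $u>1$ be its fundamental unit (at the real embedding with $\sqrt D>0$), and put $\varepsilon=u$ if $\mathrm{N}_{K/\mathbb{Q}}(u)=1$ and $\varepsilon=u^2$ if $\mathrm{N}_{K/\mathbb{Q}}(u)=-1$. For $k\geq0$ put $t_k=t_k(D):=\mathrm{Tr}_{K/\mathbb{Q}}(\varepsilon^k)=\varepsilon^k+\varepsilon^{-k}\in\mathbb{Z}$. $\Psi_m(X)\in\mathbb{Z}[X]$ denotes the minimal polynomial over $\mathbb{Q}$ of $\zeta_m+\zeta_m^{-1}=2\cos(2\pi/m)$, $\zeta_m$ a primitive $m$-th root of unity (so $\Psi_1(X)=X-2$, $\Psi_2(X)=X+2$, $\Psi_3(X)=X+1$). For a prime $p\nmid 2D$, $o(p)$ is the multiplicative order of the image of $\varepsilon$ in $(\mathcal{O}_K/p\mathcal{O}_K)^\times$, and $a_p:=v_{\mathfrak p}(\varepsilon^{o(p)}-1)$, where $\mathfrak p$ is any prime of $\mathcal{O}_K$ above $p$ and $v_{\mathfrak p}$ is normalized by $v_{\mathfrak p}(p)=1$ (this does not depend on the choice of $\mathfrak p$). $v_p$ is the $p$-adic valuation on $\mathbb{Q}$. For $p\nmid 2mD$, $\rho_m(p):=\min\{k\geq1: p\mid\Psi_m(t_k)\}$, with $\rho_m(p)=\infty$ if there is no such $k$. *)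

(* Defs.v *)
(* K = Q(sqrt D) is realised inside algC, so its real embedding with sqrt D > 0
   is the inclusion, and the order of algC is the usual order on the elements
   of K. *)
From HB Require Import structures.
From mathcomp Require Export all_boot all_order all_algebra all_field.
From mathcomp Require Import ring.
From mathcomp Require Export boolp classical_sets functions cardinality.
Set Implicit Arguments.
Unset Strict Implicit.
Unset Printing Implicit Defensive.
Import Order.TTheory GRing.Theory Num.Theory.

Local Open Scope ring_scope.

Definition squarefree (D : nat) : Prop :=
  forall q : nat, (q ^ 2 %| D)%N -> q = 1%N.

Definition quad_elt (D : nat) (ab : rat * rat) : algC :=
  ratr ab.1 + ratr ab.2 * sqrtC D%:R.

Definition quad_field (D : nat) : {pred algC} :=
  fun x => `[< exists ab, x = quad_elt D ab >].

(* For D > 1 square-free, sqrt D is irrational, so the coordinates (a, b) of an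
   element a + b sqrt D of K are unique. *)
Definition quad_conj (D : nat) (x : algC) : algC :=
  let ab := xget (0, 0) [set ab | x = quad_elt D ab]%classic in
  quad_elt D (ab.1, - ab.2).

Definition quad_trace (D : nat) (x : algC) : algC := x + quad_conj D x.
Definition quad_norm (D : nat) (x : algC) : algC := x * quad_conj D x.

Definition quad_int (D : nat) : {pred algC} :=
  fun x => (x \in quad_field D) && (x \in Aint).

Lemma quad_int_subring (D : nat) : subring_closed (quad_int D).
Proof.
have sqrtD2 : sqrtC D%:R * sqrtC D%:R = D%:R :> algC by rewrite -expr2 sqrtCK.
split.
- rewrite unfold_in Aint1 andbT; apply/asboolP; exists (1, 0).
  by rewrite /quad_elt rmorph1 rmorph0 mul0r addr0.
- move=> x y /andP[/asboolP[[a b] xE] xA] /andP[/asboolP[[c d] yE] yA].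
  rewrite unfold_in rpredB // andbT; apply/asboolP; exists (a - c, b - d).
  by rewrite xE yE /quad_elt /= !rmorphB mulrBl addrACA opprD.
- move=> x y /andP[/asboolP[[a b] xE] xA] /andP[/asboolP[[c d] yE] yA].
  rewrite unfold_in rpredM // andbT; apply/asboolP.
  exists (a * c + b * d * D%:R, a * d + b * c).
  rewrite xE yE /quad_elt /= !rmorphD !rmorphM /= rmorph_nat.
  by move: (sqrtC _) sqrtD2 => s <-; ring.
Qed.

HB.instance Definition _ (D : nat) :=
  GRing.isSubringClosed.Build algC (quad_int D) (quad_int_subring D).

Record OK (D : nat) : Type := OKelt { OKval :> algC; _ : OKval \in quad_int D }.

HB.instance Definition _ (D : nat) := [isSub for @OKval D].
HB.instance Definition _ (D : nat) := [Choice of OK D by <:].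
HB.instance Definition _ (D : nat) :=
  [SubChoice_isSubComNzRing of OK D by <:].

Definition least (P : pred nat) : option nat :=
  if pselect (exists n, P n) is left exP then Some (ex_minn exP) else None.

Section Ideals.
Variable R : comNzRingType.
Implicit Types (I J : {pred R}) (x : R).

Definition ideal_mul I J : {pred R} := fun z => `[< exists s : seq (R * R),
  all (fun xy => (xy.1 \in I) && (xy.2 \in J)) s /\
  z = \sum_(xy <- s) xy.1 * xy.2 >].

Definition ideal_exp I (n : nat) : {pred R} := iter n (ideal_mul I) predT.

Definition ideal_ord I x : nat :=
  xget 0%N [set n | (x \in ideal_exp I n) && (x \notin ideal_exp I n.+1)]%classic.

(* The valuation at the prime I above p, normalized to take the value 1 at p. *)
Definition ideal_val (p : nat) I x : rat :=
  (ideal_ord I x)%:R / (ideal_ord I p%:R)%:R.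

Definition is_ring_unit x : Prop := exists y, x * y = 1.

(* Order of the class of x in (R/pR)^*; junk value 0 if there is none. *)
Definition order_mod (p : nat) x : nat := odflt 0%N
  (least (fun n => (0 < n)%N && `[< exists y, x ^+ n = 1 + p%:R * y >])).

End Ideals.

Definition is_fundamental_unit (D : nat) (u : OK D) : Prop :=
  [/\ is_ring_unit u, 1 < val u &
      forall v : OK D, is_ring_unit v ->
        exists (b : bool) (n : int), val v = (-1) ^+ b * val u ^ n].

(* For D > 1 square-free there is exactly one fundamental unit (Dirichlet's unit
   theorem), and the default 1 is not used. *)
Definition fundamental_unit (D : nat) : OK D :=
  xget 1 [set u | is_fundamental_unit u]%classic.

Definition eps (D : nat) : OK D :=
  let u := fundamental_unit D in
  if quad_norm D (val u) == 1 then u else u ^+ 2.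

(* The trace of an algebraic integer is an integer, so that Num.floor only moves
   it from algC to int. *)
Definition t (D k : nat) : int := Num.floor (quad_trace D (val (eps D ^+ k))).

(* The minimal polynomial of an algebraic integer has integer coefficients;
   compare the library's definition of 'Phi_n. *)
Definition Psi (m : nat) : {poly int} :=
  let: exist z _ := C_prim_root_exists (ltn0Sn m.-1) in
  map_poly Num.floor (minCpoly (z + z^-1)).

Definition ord_eps (D p : nat) : nat := order_mod p (eps D).

(* None stands for infinity. *)
Definition rho (D m p : nat) : option nat :=
  least (fun k => (0 < k)%N && (p%:Z %| (Psi m).[t D k])%Z).

Definition Dk_pairs : set (nat * nat) :=
  [set Dk | [/\ (1 < Dk.1)%N, squarefree Dk.1 & (1 <= Dk.2)%N]]%classic.

(* For sets of positive integers; the other elements of S are not counted. *)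
Definition has_density (S : set int) (d : rat) : Prop :=
  forall e : rat, 0 < e -> exists N0 : nat, forall N : nat, (N0 <= N)%N ->
    (0 < N)%N ->
    `| (count (fun i => `[< S i%:Z >]) (iota 1 N))%:R / N%:R - d | < e.

(* Main.v *)
(* Write s = x + 1/x. Then t_k = V_k(t_1) for the Chebyshev-like sequence
   V_k(s) = x^k + x^-k, and V_n(s) - 2 = (x^n - 1)^2 / x^n is the product over
   d | n of F_d(s) = Phi_d(x)^2 / x^phi(d), where F_1 = X - 2, F_2 = X + 2 and
   F_d = Psi_d^2 for d >= 3; this is (ii). A solution of s^2 - 4 = D f^2 with D
   square-free makes (s + f sqrt D) / 2 a unit of norm 1 of Q(sqrt D), that is a
   power of eps, which gives (i).

   For (iii) and (iv), the k such that p | V_k(s) - 2 are the multiples of a rank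
   a, and a = o(p) if s = t_1 and p does not divide 2D. If p | F_m(s) then
   m = a p^j. The valuations follow by lifting the exponent. If n > 12 were the
   rank of no prime, then Psi_n(s) would be 1 or a prime factor of n, but F_n(s)
   exceeds the square of such a prime. *)
From HB Require Import structures.
Require Import Defs.
From mathcomp Require Import all_boot all_order all_algebra all_fingroup.
From mathcomp Require Import all_solvable all_field.
From mathcomp Require Import boolp classical_sets functions cardinality.
From mathcomp Require Import ring zify.
Set Implicit Arguments.
Unset Strict Implicit.
Unset Printing Implicit Defensive.
Import Order.TTheory GRing.Theory Num.Theory.
Local Open Scope ring_scope.

(** Except for the valuation at a prime ideal, the arithmetic is done in the integers: a rank is
    defined for every integer s and every prime p by divisibility of [lucV s k - 2], so the
    splitting of p in K never has to be distinguished. The passage to the ring of integers rests on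
    one fact: for p prime to 2D, an element whose trace and norm are divisible by p is itself
    divisible by p. This identifies o(p) with a rank, and it yields v_p(t_o - 2) = 2 a_p for o =
    o(p) without a factorization of (p).

    The bound 12 is where coincidences between two non-primitive primes stop. Such a prime p
    satisfies n = a p^(j+1) with a dividing p - 1 or p + 1, and two of them for the same n can only
    be 2 and 3, with n <= 12. For s = 3 this happens: Psi_12(3) = 6, where 2 has rank 3 and 3 has
    rank 4. Beyond 12 there is at most one such prime, and it divides Psi_n(s) only once; this makes
    a comparison of sizes decisive. *)

Local Notation pZtoC := (map_poly (intr : int -> algC)).
Local Notation pQtoC := (map_poly (ratr : rat -> algC)).

(** * Chebyshev-like sequences *)

(** This is 2 T_n(s/2), with T_n the Chebyshev polynomial of the first kind. It is defined over any
    ring, so that [lucV 'X n] is the polynomial and [lucV s n] its values. *)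
Fixpoint lucV (R : pzRingType) (s : R) (n : nat) : R :=
  match n with
  | 0 => 2
  | n'.+1 => if n' is n''.+1 then s * lucV s n' - lucV s n'' else s
  end.

Lemma lucVSS (R : pzRingType) (s : R) n :
  lucV s n.+2 = s * lucV s n.+1 - lucV s n.
Proof. by []. Qed.

Lemma lucV_ind2 (P : nat -> Prop) :
  P 0 -> P 1 -> (forall n, P n -> P n.+1 -> P n.+2) -> forall n, P n.
Proof.
move=> P0 P1 PS n; suff [] : P n /\ P n.+1 by [].
by elim: n => [//|n [Pn PSn]]; split=> //; apply: PS.
Qed.

Lemma rmorph_lucV (R S : pzRingType) (f : {rmorphism R -> S}) s n :
  f (lucV s n) = lucV (f s) n.
Proof.
elim/lucV_ind2: n => [||n IH0 IH1]; rewrite ?lucVSS //=.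
  by rewrite rmorph_nat.
by rewrite rmorphB rmorphM IH0 IH1.
Qed.

Lemma lucV_addE (R : comPzRingType) (x y : R) n :
  x * y = 1 -> lucV (x + y) n = x ^+ n + y ^+ n.
Proof.
move=> xy1; elim/lucV_ind2: n => [||n IH0 IH1]; first by rewrite !expr0.
  by rewrite !expr1.
rewrite lucVSS IH0 IH1 !exprS -[x ^+ n in X in _ - X]mul1r.
by rewrite -[y ^+ n in X in _ - X]mul1r -xy1; ring.
Qed.

Lemma add_inv_split (s : algC) : exists x : algC, x != 0 /\ s = x + x^-1.
Proof.
have [x xE] := solve_monicpoly (fun i => if i == 0 then -1 else s) (ltn0Sn 1).
rewrite !big_ord_recl big_ord0 /= expr0 expr1 mulr1 addr0 in xE.
have x0 : x != 0.
  by apply/eqP => x0; move: xE; rewrite x0 expr0n mulr0 addr0 => /eqP;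
     rewrite eq_sym oppr_eq0 oner_eq0.
exists x; split=> //; apply: (mulIf x0).
have -> : s * x = x ^+ 2 + 1 by rewrite xE; ring.
by rewrite mulrDl mulVf // expr2.
Qed.

(** Integer identities between the [lucV s n] are proved below by expanding in x and y and using x y
    = 1. *)
Lemma lucV_int (s : int) : exists x y : algC,
  x * y = 1 /\ forall n, (lucV s n)%:~R = x ^+ n + y ^+ n.
Proof.
have [x [x0 sE]] := add_inv_split s%:~R.
exists x, x^-1; split=> [|n]; first by rewrite divff.
by rewrite rmorph_lucV /= sE lucV_addE ?divff.
Qed.

Lemma lucV_comp (s : int) k n : lucV (lucV s k) n = lucV s (k * n).
Proof.
apply: (intr_inj (R := algC)).
have [x [y [xy1 VE]]] := lucV_int s.
rewrite rmorph_lucV /= !VE lucV_addE -?exprMn ?xy1 ?expr1n //.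
by rewrite !exprM.
Qed.

Lemma lucV_mul (s : int) b c :
  lucV s (b + c) * lucV s b = lucV s (b + (b + c)) + lucV s c.
Proof.
apply: (intr_inj (R := algC)); have [x [y [xy1 VE]]] := lucV_int s.
rewrite rmorphM rmorphD /= !VE !exprD.
have : x ^+ b * y ^+ b = 1 by rewrite -exprMn xy1 expr1n.
move: (x ^+ b) (y ^+ b) (x ^+ c) (y ^+ c) => X Y Z W E.
rewrite -[Z in X in _ = _ + X]mul1r -[W in X in _ = _ + X]mul1r -E; ring.
Qed.

(* Together with [lucV_mul], this makes the set of the k with
   [p %| lucV s k - 2] closed under addition and subtraction; for the indices p
   and 1 it bounds the rank, as [lucV s p] is congruent to s modulo p. *)
Lemma lucV_sub_sqr (s : int) b c :
  (lucV s (b + (b + c)) - 2) * (lucV s c - 2) = (lucV s (b + c) - lucV s b) ^+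
    2.
Proof.
apply: (intr_inj (R := algC)); have [x [y [xy1 VE]]] := lucV_int s.
rewrite rmorphXn rmorphM !rmorphB /= !VE !exprD.
have : x ^+ b * y ^+ b = 1 by rewrite -exprMn xy1 expr1n.
have : x ^+ c * y ^+ c = 1 by rewrite -exprMn xy1 expr1n.
move: (x ^+ b) (y ^+ b) (x ^+ c) (y ^+ c) => X Y Z W E' E.
(* The difference of the two sides, written explicitly in the ideal generated by X Y - 1 and Z W -
   1. *)
apply: subr0_eq; transitivity ((Z * W - 1) * (X ^+ 2 + Y ^+ 2 - 2 * (X * Y)) +
  (X * Y - 1) * (2 * (Z + W) - 4)); first by ring.
by rewrite E E' subrr !mul0r addr0.
Qed.

Lemma Euclid_dvdzM (p : nat) (a b : int) : prime p ->
  (p%:Z %| a * b)%Z = (p%:Z %| a)%Z || (p%:Z %| b)%Z.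
Proof. by move=> pp; rewrite !dvdzE abszM Euclid_dvdM. Qed.

Lemma Euclid_dvdzX (p : nat) (a : int) n : prime p ->
  (p%:Z %| a ^+ n.+1)%Z = (p%:Z %| a)%Z.
Proof. by move=> pp; rewrite !dvdzE abszX Euclid_dvdX ?andbT. Qed.

(** [lucV_mul] shows that p divides the sum of the two numbers, [lucV_sub_sqr] that p divides their
    product; hence p divides both. *)
Lemma lucV_dvd_addsub (s : int) p b c : prime p ->
  (p%:Z %| lucV s (b + c) - 2)%Z -> (p%:Z %| lucV s b - 2)%Z ->
  (p%:Z %| lucV s (b + (b + c)) - 2)%Z && (p%:Z %| lucV s c - 2)%Z.
Proof.
move=> pp hbc hb.
have hS : (p%:Z %| (lucV s (b + (b + c)) - 2) + (lucV s c - 2))%Z.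
  have -> : lucV s (b + (b + c)) - 2 + (lucV s c - 2) =
    (lucV s (b + c) - 2) * lucV s b + (lucV s b - 2) *+ 2.
    by rewrite mulrBl lucV_mul; ring.
  by rewrite rpredD ?dvdz_mulr // rpredMn.
have hP : (p%:Z %| (lucV s (b + (b + c)) - 2) * (lucV s c - 2))%Z.
  rewrite lucV_sub_sqr Euclid_dvdzX //.
  have -> : lucV s (b + c) - lucV s b = (lucV s (b + c) - 2) - (lucV s b - 2).
    by ring.
  by rewrite rpredB.
move: hP; rewrite Euclid_dvdzM // => /orP[h|h]; rewrite h /=.
  by rewrite -(rpredDl _ h).
by rewrite andbT -(rpredDr _ h).
Qed.

Lemma lucV_dvd_mul (s : int) p a k : prime p ->
  (p%:Z %| lucV s a - 2)%Z -> (p%:Z %| lucV s (k * a) - 2)%Z.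
Proof.
move=> pp ha; elim/lucV_ind2: k => [||k IH0 IH1].
- by rewrite mul0n /= subrr dvdz0.
- by rewrite mul1n.
rewrite !mulSn in IH1 *; by case/andP: (lucV_dvd_addsub pp IH1 ha).
Qed.

Lemma dvdz_exp_sub (s : int) p : prime p -> (p%:Z %| s ^+ p - s)%Z.
Proof.
move=> pp; rewrite (dvdz_pcharf (pchar_Fp pp)) rmorphB rmorphXn /=.
by rewrite -[X in _ ^+ X](card_Fp pp) expf_card subrr.
Qed.

(** Expand (x + y)^n in both orders and add: the terms of index i combine to V_|n-2i|, since x y =
    1. Doubling spares a separate middle term. *)
Lemma lucV_binomial (s : int) n :
  s ^+ n *+ 2 = \sum_(i < n.+1) lucV s (maxn (n - i) i - minn (n - i) i) *+
    'C(n, i).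
Proof.
apply: (intr_inj (R := algC)); have [x [y [xy1 VE]]] := lucV_int s.
have sE : s%:~R = x + y by rewrite -[s]/(lucV s 1) VE.
have key a b : x ^+ a * y ^+ b + y ^+ a * x ^+ b =
    (lucV s (maxn a b - minn a b))%:~R.
  wlog ab : a b / (b <= a)%N.
    move=> W; case/orP: (leq_total a b) => h; last exact: W.
    by rewrite maxnC minnC -W //; ring.
  have [c ->] : exists c, a = (b + c)%N by exists (a - b)%N; rewrite subnKC.
  rewrite (maxn_idPl (leq_addr _ _)) (minn_idPr (leq_addr _ _)) addKn VE !exprD.
  have : x ^+ b * y ^+ b = 1 by rewrite -exprMn xy1 expr1n.
  move: (x ^+ b) (y ^+ b) => X Y E; rewrite mulrAC E mul1r; congr (_ + _).
  by rewrite mulrAC (mulrC Y) E mul1r.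
rewrite raddfMn raddf_sum /= rmorphXn /= sE mulr2n {2}[x + y]addrC !exprDn.
rewrite -big_split /=; apply: eq_bigr => i _.
by rewrite raddfMn /= -key mulrnDl.
Qed.

(** Frobenius: x^p + y^p is congruent to (x + y)^p = s^p, hence to s. The factor 2 of
    [lucV_binomial] has to be cancelled, so p = 2 is checked directly. *)
Lemma dvdz_lucV_prime (s : int) p : prime p -> (p%:Z %| lucV s p - s)%Z.
Proof.
move=> pp; have [-> | p2] := eqVneq p 2.
  have -> : lucV s 2 - s = (s ^+ 2 - s) - 2 by rewrite /=; ring.
  by rewrite rpredB // dvdz_exp_sub.
have [q pE] : exists q, p = q.+2 by move: (prime_gt1 pp);
  case: p {pp p2} => [|[|q]] // _; exists q.
rewrite pE in pp p2 *; have : (q.+2%:Z %| s ^+ q.+2 *+ 2 - lucV s q.+2 *+ 2)%Z.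
  rewrite lucV_binomial big_ord_recl big_ord_recr.
  have e0 : nat_of_ord (ord0 : 'I_q.+3) = 0%N by [].
  have e1 : nat_of_ord (lift ord0 (ord_max : 'I_q.+2)) = q.+2 by [].
  rewrite e0 e1 (_ : maxn (q.+2 - 0) 0 - minn (q.+2 - 0) 0 = q.+2)%N;
    last by lia.
  rewrite (_ : maxn (q.+2 - q.+2) q.+2 - minn (q.+2 - q.+2) q.+2 = q.+2)%N;
    last by lia.
  rewrite bin0 binn !mulr1n; move: (lucV s q.+2) => v /=.
  rewrite addrCA -mulr2n addrK.
  apply: rpred_sum => i _; rewrite -mulr_natr natz dvdz_mull // dvdzE.
  by apply: prime_dvd_bin => //; have := ltn_ord i; rewrite /= /bump; lia.
rewrite -mulrnBl -mulr_natr natz Euclid_dvdzM // => /orP[|h]; last first.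
  by move: h; rewrite dvdzE /= dvdn_prime2 // (negPf p2).
rewrite -(rpredBr _ (dvdz_exp_sub s pp)) => h; rewrite -rpredN.
by move: h; congr (is_true (_ %| _)%Z); ring.
Qed.

Lemma lucV_rank_exists (s : int) p : prime p ->
  exists a, [/\ (0 < a)%N, (forall k, (p%:Z %| lucV s k - 2)%Z = (a %| k)%N)
                & (a %| p.-1)%N || (a %| p.+1)%N].
Proof.
move=> pp; pose P k := (0 < k)%N && (p%:Z %| lucV s k - 2)%Z.
have pS : p = p.-1.+1 by rewrite prednK ?prime_gt0.
have h : (p%:Z %| lucV s p.-1 - 2)%Z || (p%:Z %| lucV s p.+1 - 2)%Z.
  have := lucV_sub_sqr s 1 p.-1; rewrite !add1n -pS mulrC => E.
  by rewrite -Euclid_dvdzM // E Euclid_dvdzX // dvdz_lucV_prime.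
have exP : exists k, P k.
  case/orP: h => h; last by exists p.+1; rewrite /P h.
  have [p1|p1] := posnP p.-1; last by exists p.-1; rewrite /P p1 h.
  by move: (prime_gt1 pp); rewrite pS p1.
have [a /andP[a0 ha] amin] := ex_minnP exP.
have aP k : (p%:Z %| lucV s k - 2)%Z = (a %| k)%N.
  apply/idP/idP => [hk|/dvdnP[c ->]]; last exact: lucV_dvd_mul.
  rewrite /dvdn; have := ltn_pmod k a0; have [//|r0] := posnP (k %% a).
  rewrite ltnNge amin // /P r0 /=.
  have hq := lucV_dvd_mul (k %/ a) pp ha.
  have := divn_eq k a => kE; rewrite {1}kE in hk.
  by case/andP: (lucV_dvd_addsub pp hk hq).
by exists a; split=> //; rewrite -!aP.
Qed.

(** Taylor expansion of V_n at s = 2, with the denominators of the second and third coefficients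
    cleared. Lifting the exponent at p needs the bracket modulo p^3, and w^3 d is then harmless when
    p divides w. *)
Lemma lucV_expand (w : int) n : exists b c d,
  [/\ lucV (w + 2) n - 2 = w * (n%:Z ^+ 2 + w * (b + w * (c + w * d))),
      12 * b = n%:Z ^+ 2 * (n%:Z ^+ 2 - 1)
    & 360 * c = n%:Z ^+ 2 * (n%:Z ^+ 2 - 1) * (n%:Z ^+ 2 - 4)].
Proof.
elim/lucV_ind2: n => [||n [b0 [c0 [d0 [E0 F0 G0]]]] [b1 [c1 [d1 [E1 F1 G1]]]]].
- by exists 0, 0, 0; split=> //=; ring.
- by exists 0, 0, 0; split=> //=; ring.
exists (2 * b1 - b0 + n.+1%:Z ^+ 2), (2 * c1 - c0 + b1),
  (2 * d1 - d0 + c1 + w * d1); split.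
- have -> : lucV (w + 2) n.+2 - 2 = (w + 2) * (lucV (w + 2) n.+1 - 2)
    - (lucV (w + 2) n - 2) + 2 * w by rewrite lucVSS; ring.
  by rewrite E0 E1 -[n.+2]addn2 -[n.+1]addn1 !PoszD; ring.
- have -> : 12 * (2 * b1 - b0 + n.+1%:Z ^+ 2) =
    2 * (12 * b1) - 12 * b0 + 12 * n.+1%:Z ^+ 2 by ring.
  by rewrite F0 F1 -[n.+2]addn2 -[n.+1]addn1 !PoszD; ring.
have -> : 360 * (2 * c1 - c0 + b1) =
    2 * (360 * c1) - 360 * c0 + 30 * (12 * b1) by ring.
by rewrite G0 G1 F1 -[n.+2]addn2 -[n.+1]addn1 !PoszD; ring.
Qed.

Lemma lucV_sub2_factor (s : int) n : exists z,
  lucV s n - 2 = (s - 2) * (n%:Z ^+ 2 + (s - 2) * z).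
Proof.
have [b [c [d [E _ _]]]] := lucV_expand (s - 2) n.
by exists (b + (s - 2) * (c + (s - 2) * d)); rewrite -E subrK.
Qed.

(** * The polynomials Psi *)

(** Every s in [algC] is some x + 1/x, so agreement at these points is agreement everywhere.
    Identities between polynomials in s thus become identities in x. *)
Lemma polyC_ext (p q : {poly algC}) :
  (forall x, x != 0 -> p.[x + x^-1] = q.[x + x^-1]) -> p = q.
Proof.
move=> pq; apply/subr0_eq/eqP/negP => /negP d0.
pose rs := [seq i%:R : algC | i <- iota 0 (size (p - q))].
have := @max_poly_roots _ (p - q) rs d0; rewrite size_map size_iota ltnn => h.
suff: false by []; apply: h.
- apply/allP => _ /mapP[i _ ->]; have [x [x0 ->]] := add_inv_split i%:R.
  by rewrite rootE hornerD hornerN pq // subrr.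
- by rewrite map_inj_uniq ?iota_uniq // => i j /eqP; rewrite eqr_nat => /eqP.
Qed.

Lemma prim_root_neq0 n (z : algC) : n.-primitive_root z -> z != 0.
Proof.
move=> zP; apply/eqP => z0; have := prim_expr_order zP.
by rewrite z0 expr0n gtn_eqF ?(prim_order_gt0 zP) // => /eqP;
  rewrite eq_sym oner_eq0.
Qed.

Lemma prim_rootV n (z : algC) : n.-primitive_root z -> n.-primitive_root z^-1.
Proof.
move=> zP; have n0 := prim_order_gt0 zP.
suff -> : z^-1 = z ^+ n.-1 by rewrite prim_root_exp_coprime // coprimePn.
have z0 := prim_root_neq0 zP.
by apply: (mulfI z0); rewrite divff // -exprS prednK // prim_expr_order.
Qed.

(** F_m over [algC]: k runs over all residues prime to m, so for m > 2 each root occurs twice, from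
    k and from m - k. *)
Definition tr_cyclo (z : algC) m : {poly algC} :=
  \prod_(k < m | coprime k m) ('X - (z ^+ k + z ^- k)%:P).

Lemma tr_cyclo_monic z m : tr_cyclo z m \is monic.
Proof. by apply: monic_prod => k _; apply: monicXsubC. Qed.

Lemma card_coprime m : #|[pred k : 'I_m | coprime k m]| = totient m.
Proof.
rewrite totient_count_coprime big_mkord -sum1_card big_mkcond /=.
by apply: eq_bigr => k _; rewrite inE coprime_sym; case: coprime.
Qed.

(** Factor by factor, (x + 1/x) - (u + 1/u) = (x - u)(x - 1/u) / x with u = z^k; one copy of Phi_m
    comes from z and the other from 1/z. *)
Lemma tr_cyclo_horner m z x : m.-primitive_root z -> x != 0 ->
  (tr_cyclo z m).[x + x^-1] = (pZtoC 'Phi_m).[x] ^+ 2 / x ^+ totient m.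
Proof.
move=> zP x0; have zV := prim_rootV zP.
have z0 := prim_root_neq0 zP.
rewrite expr2 {1}(Cintr_Cyclotomic zP) (Cintr_Cyclotomic zV) /cyclotomic.
rewrite !horner_prod -card_coprime -prodr_const -prodfV -!big_split /=.
apply: eq_bigr => k _; rewrite !hornerXsubC exprVn.
have u0 : z ^+ k != 0 by rewrite expf_neq0.
by move: (z ^+ k) u0 => u u0; field; rewrite x0 u0.
Qed.

Lemma big_divisors (R : Type) (idx : R) (op : Monoid.com_law idx) n F :
  (0 < n)%N ->
  \big[op/idx]_(d <- divisors n) F d = \big[op/idx]_(d < n.+1 | (d %| n)%N) F d.
Proof.
move=> n0; rewrite -(big_mkord (fun d => d %| n)%N) -[RHS]big_filter.
apply: perm_big; apply: uniq_perm;
  rewrite ?divisors_uniq ?filter_uniq ?iota_uniq //.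
move=> d; rewrite mem_filter mem_index_iota -dvdn_divisors // ltnS.
by case: (boolP (d %| n)%N) => // /dvdn_leq ->.
Qed.

Lemma lucVX_horner (R : comNzRingType) (s : R) n : (lucV 'X n).[s] = lucV s n.
Proof. by rewrite -horner_evalE rmorph_lucV /= horner_evalE hornerX. Qed.

(** The square of X^n - 1 = prod Phi_d, divided by x^n, where n is the sum of the phi(d) over d |
    n. *)
Lemma prod_tr_cyclo n z : n.-primitive_root z ->
  lucV 'X n - 2 = \prod_(d <- divisors n) tr_cyclo (z ^+ (n %/ d)) d.
Proof.
move=> zP; have n0 := prim_order_gt0 zP; apply: polyC_ext => x x0.
rewrite hornerD hornerN lucVX_horner lucV_addE ?divff // horner_prod.
have -> : (2 : {poly algC}).[x + x^-1] = 2
  by rewrite -[2]/(2%:R) hornerMn hornerC.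
transitivity ((('X^n - 1 : {poly algC}).[x]) ^+ 2 / x ^+ n).
  rewrite !hornerE exprVn.
  have := expf_neq0 n x0; move: (x ^+ n) => u u0; field; exact: u0.
rewrite -[n in x ^+ n](sum_totient_dvd n) -big_divisors // -prodrXr -prodfV.
rewrite (prod_cyclotomic zP) horner_prod -prodrXl -big_split /=.
apply: eq_big_seq => d; rewrite -dvdn_divisors // => dn.
have zd : d.-primitive_root (z ^+ (n %/ d)) by apply: dvdn_prim_root.
by rewrite tr_cyclo_horner // (Cintr_Cyclotomic zd).
Qed.

(** By induction, this factor is the quotient of the rational polynomial V_m - 2 by the rational
    factors of the proper divisors of m. *)
Lemma tr_cyclo_rat m z : m.-primitive_root z ->
  exists f : {poly rat}, tr_cyclo z m = pQtoC f.
Proof.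
elim/ltn_ind: m z => m IH z zP; have m0 := prim_order_gt0 zP.
have [um _ inD] := divisors_correct m0.
have prodQ (s : seq nat) (G : nat -> {poly algC}) :
    (forall d, d \in s -> exists f, G d = pQtoC f) ->
  exists f, \prod_(d <- s) G d = pQtoC f.
  elim: s => [|d s IHs] h; first by exists 1; rewrite big_nil rmorph1.
  have [f fE] := h d (mem_head _ _).
  have [|g gE] := IHs; first by move=> e es; apply: h; rewrite inE es orbT.
  by exists (f * g); rewrite big_cons fE gE rmorphM.
have [|P PE] := prodQ (rem m (divisors m)) (fun d => tr_cyclo (z ^+ (m %/ d))
  d).
  move=> d; rewrite mem_rem_uniq // inE inD => /andP[d'm dm].
  by apply: IH; rewrite ?dvdn_prim_root // ltn_neqAle d'm dvdn_leq.
have P0 : pQtoC P != 0.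
  by rewrite -PE monic_neq0 // monic_prod // => d _; apply: tr_cyclo_monic.
exists ((lucV 'X m - 2) %/ P);
  rewrite map_divp rmorphB /= rmorph_lucV /= map_polyX.
rewrite rmorph_nat (prod_tr_cyclo zP) (big_rem m) ?inD //= divnn m0 expr1 PE.
by rewrite mulpK.
Qed.

Definition tr_min (z : algC) m : {poly algC} :=
  \prod_(k < m | coprime k m && (k.*2 < m)%N) ('X - (z ^+ k + z ^- k)%:P).

Lemma tr_min_monic z m : tr_min z m \is monic.
Proof. by apply: monic_prod => k _; apply: monicXsubC. Qed.

(** The reflection k -> m - k exchanges the two halves. It has no fixed point: 2k = m with k prime
    to m would give k = 1 and m = 2. *)
Lemma tr_cyclo_sqr m z : (2 < m)%N -> m.-primitive_root z ->
  tr_cyclo z m = tr_min z m ^+ 2.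
Proof.
move=> m2 zP; have z0 := prim_root_neq0 zP.
have c0 : coprime 0 m = false by rewrite /coprime gcd0n; lia.
pose G k := 'X - (z ^+ k + z ^- k)%:P : {poly algC}.
rewrite /tr_cyclo (bigID (fun k : 'I_m => k.*2 < m)%N) /= expr2; congr (_ * _).
rewrite /tr_min -(big_mkord (fun k => coprime k m && ~~ (k.*2 < m)%N) G).
rewrite -(big_mkord (fun k => coprime k m && (k.*2 < m)%N) G).
have drop0 (P : pred nat) : ~~ P 0%N ->
    \prod_(0 <= k < m | P k) G k = \prod_(1 <= k < m | P k) G k.
  by move=> /negPf P0; rewrite big_ltn_cond ?P0 // (ltnW (ltnW m2)).
rewrite !drop0 ?c0 // big_nat_rev /=.
rewrite big_nat_cond [RHS]big_nat_cond;
  apply: eq_big => [k|k /andP[/andP[k0 km] _]].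
  case: (boolP (0 < k < m)%N) => //= /andP[k0 km].
  have -> : (1 + m - k.+1 = m - k)%N by lia.
  have -> : coprime (m - k) m = coprime k m.
    have mE : (m = k + (m - k))%N by lia.
    by rewrite mE addKn /coprime gcdnDr gcdnDl gcdnC.
  case: (boolP (coprime k m)) => //= ckm.
  have : (k.*2 != m)%N.
    apply/eqP => km2; move: ckm; rewrite -km2 -muln2 /coprime gcdnMr.
    by move=> /eqP k1; move: km2; rewrite k1; lia.
  lia.
have -> : (1 + m - k.+1 = m - k)%N by lia.
rewrite /G; congr ('X - _%:P).
have zk0 : z ^+ k != 0 by rewrite expf_neq0.
have -> : z ^+ (m - k) = z ^- k.
  apply: (mulIf zk0); rewrite mulVf // -exprD subnK ?(ltnW km) //.
  exact: prim_expr_order zP.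
by rewrite invrK addrC.
Qed.

Lemma minCpoly_trace m z k : m.-primitive_root z -> coprime k m ->
  minCpoly (z ^+ k + z ^- k) = minCpoly (z + z^-1).
Proof.
move=> zP ckm; have [u uE] := Qn_aut_exists ckm.
by rewrite -(minCpoly_aut u (z + z^-1)) rmorphD fmorphV /= uE //
  prim_expr_order.
Qed.

(** The roots are Galois conjugates of z + 1/z, and they are distinct: equality for k and j means
    (z^k - z^j)(z^(k+j) - 1) = 0, while 0 < k + j < m. *)
Lemma tr_min_dvd m z : (2 < m)%N -> m.-primitive_root z ->
  tr_min z m %| minCpoly (z + z^-1).
Proof.
move=> m2 zP; have z0 := prim_root_neq0 zP.
rewrite /tr_min -big_filter.
set s := [seq k <- _ | _].
rewrite -(big_map (fun k : 'I_m => z ^+ k + z ^- k) xpredT (fun w => 'X -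
  w%:P)).
have sP (k : 'I_m) : k \in s -> coprime k m && (k.*2 < m)%N.
  by rewrite mem_filter => /andP[].
apply: uniq_roots_dvdp.
  apply/allP => _ /mapP[k /sP/andP[ckm _] ->].
  by rewrite -(minCpoly_trace zP ckm) root_minCpoly.
rewrite uniq_rootsE map_inj_in_uniq ?filter_uniq ?index_enum_uniq //.
have pos (k : 'I_m) : coprime k m -> (0 < k)%N.
  by rewrite lt0n; case: eqP => // ->; rewrite /coprime gcd0n; lia.
move=> k j /sP/andP[ck k2] /sP/andP[cj j2] E.
have [k0 j0] := (pos _ ck, pos _ cj).
have zk0 : z ^+ k != 0 by rewrite expf_neq0.
have zj0 : z ^+ j != 0 by rewrite expf_neq0.
have : (z ^+ k - z ^+ j) * (z ^+ k * z ^+ j - 1) = 0.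
  transitivity (z ^+ k * z ^+ j * ((z ^+ k + z ^- k) - (z ^+ j + z ^- j))).
    by move: (z ^+ k) (z ^+ j) zk0 zj0 => a b a0 b0; field; rewrite a0 b0.
  by rewrite E subrr mulr0.
move/eqP; rewrite mulf_eq0 !subr_eq0 => /orP[|].
  rewrite (eq_prim_root_expr zP) !modn_small //; by move/eqP/val_inj.
rewrite -exprD -(expr0 z) (eq_prim_root_expr zP) mod0n modn_small; lia.
Qed.

(* The minimal polynomial lies between [tr_min] and its square; a further factor
   would give it a double root, that is a root of its derivative. *)
Lemma minCpoly_trace_eq m z : (2 < m)%N -> m.-primitive_root z ->
  minCpoly (z + z^-1) = tr_min z m.
Proof.
move=> m2 zP; have RM := tr_min_dvd m2 zP.
apply/eqP; rewrite -eqp_monic ?minCpoly_monic ?tr_min_monic // /eqp RM andbT.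
have [f fE] := tr_cyclo_rat zP.
have MF : minCpoly (z + z^-1) %| tr_min z m ^+ 2.
  rewrite -(tr_cyclo_sqr m2 zP) fE; have [p [-> _] pP] := minCpolyP (z + z^-1).
  rewrite dvdp_map -pP -fE rootE /tr_cyclo horner_prod; apply/prodf_eq0.
  by exists (Ordinal (ltnW m2));
    rewrite /= ?coprime1n // hornerXsubC expr1 subrr eqxx.
have /dvdpP[S SE] := RM; rewrite SE in MF *.
have R0 : tr_min z m != 0 by rewrite monic_neq0 ?tr_min_monic.
rewrite expr2 dvdp_mul2r // in MF.
have [S1|/closed_rootP[r rS]] := eqVneq (size S) 1.
  by move: S1 => /eqP/size_poly1P[c c0 ->]; rewrite mul_polyC dvdpZl.
have : root (tr_min z m) r by apply: (root_dvdp MF).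
rewrite /root /tr_min horner_prod => /prodf_eq0[k /andP[ckm _]].
rewrite hornerXsubC subr_eq0 => /eqP rE.
have [p [pE pm] pP] := minCpolyP r.
have pE' : pQtoC p = S * tr_min z m
  by rewrite -pE -SE rE (minCpoly_trace zP ckm).
have rR : root (tr_min z m) r by apply: (root_dvdp MF).
have : root (pQtoC p^`()) r.
  rewrite -deriv_map pE' derivM rootE hornerD !hornerM.
  by move: rS rR; rewrite !rootE => /eqP -> /eqP ->; rewrite mulr0 mul0r addr0.
rewrite pP => pdp; have p0 := monic_neq0 pm.
have d0 : p^`() != 0.
  have := size_minCpoly r; rewrite pE size_map_poly -subn_gt0 subn1 => sp.
  apply/eqP => /polyP/(_ (size p).-2); rewrite coef_deriv coef0 prednK //.
  move/eqP; rewrite -lead_coefE (monicP pm) mulrn_eq0 oner_eq0 orbF.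
  by rewrite gtn_eqF.
by have := lt_size_deriv p0; rewrite ltnNge dvdp_leq.
Qed.

Lemma Psi_tr_min m : (2 < m)%N ->
  exists2 z, m.-primitive_root z & pZtoC (Psi m) = tr_min z m.
Proof.
move=> m2; rewrite /Psi; case: C_prim_root_exists => z /=.
rewrite prednK ?(ltnW (ltnW m2)) // => zP; exists z => //.
rewrite (minCpoly_trace_eq m2 zP) floorpK //.
rewrite -(minCpoly_trace_eq m2 zP); apply: (_ : _ \in Aint).
have zA : z \in Aint := Aint_prim_root zP.
by rewrite rpredD // (Aint_prim_root (prim_rootV zP)).
Qed.

(* The polynomial F_m above. *)
Definition Psi_sqr (m : nat) : {poly int} :=
  if m == 1%N then 'X - 2 else if m == 2 then 'X + 2 else Psi m ^+ 2.

Lemma Psi_sqrE m z : m.-primitive_root z -> pZtoC (Psi_sqr m) = tr_cyclo z m.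
Proof.
move=> zP; have m0 := prim_order_gt0 zP; rewrite /Psi_sqr.
have [m1|m1] := eqVneq m 1%N.
  rewrite m1 /tr_cyclo big_mkcond big_ord_recl big_ord0 /= !expr0 invr1 mulr1.
  by rewrite rmorphB /= map_polyX rmorph_nat polyCD.
have [m2|m2] := eqVneq m 2%N.
  have z1 : z = -1.
    have := prim_expr_order zP; rewrite m2 => /eqP;
      rewrite sqrf_eq1 => /orP[|/eqP//].
    move=> /eqP z1; have := eq_prim_root_expr zP 1 0.
    by rewrite z1 !expr1n eqxx m2.
  rewrite m2 /tr_cyclo !big_mkcond !big_ord_recl big_ord0 /= mul1r mulr1 expr1.
  rewrite z1 invrN1 rmorphD /= map_polyX rmorph_nat -opprD polyCN opprK.
  by rewrite polyCD.
have m3 : (2 < m)%N by lia.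
have [z' zP' E] := Psi_tr_min m3.
rewrite rmorphXn /= E -tr_cyclo_sqr //; apply: polyC_ext => x x0.
by rewrite !tr_cyclo_horner.
Qed.

Lemma prod_Psi_sqr (s : int) n : (0 < n)%N ->
  lucV s n - 2 = \prod_(d <- divisors n) (Psi_sqr d).[s].
Proof.
move=> n0; have [z zP] := C_prim_root_exists n0.
rewrite -horner_prod;
  have -> : \prod_(d <- divisors n) Psi_sqr d = lucV 'X n - 2.
  apply: (map_inj_poly (intr_inj : injective (intr : int -> algC))) => //.
  rewrite rmorphB /= rmorph_lucV /= map_polyX rmorph_nat (prod_tr_cyclo zP).
  rewrite rmorph_prod /=; apply: eq_big_seq => d;
    rewrite -dvdn_divisors // => dn.
  by apply: Psi_sqrE; apply: dvdn_prim_root.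
rewrite hornerD hornerN lucVX_horner; congr (_ - _).
by rewrite -[2]/(2%:R) -[RHS]/((2%:R : {poly int}).[s]) hornerMn hornerC.
Qed.

(** * Bounds on the values of Psi and F_m *)

(** As |z| = 1, the inverse of z^k is its complex conjugate. Each linear factor at s therefore lies
    between s - 2 and s + 2, the source of all size estimates below. *)
Lemma trace_root_bound m (z : algC) k : m.-primitive_root z ->
  -2 <= z ^+ k + z ^- k <= 2.
Proof.
move=> zP; have m0 := prim_order_gt0 zP.
have z1 : `|z| = 1.
  have /eqP := prim_expr_order zP; move/eqP/(congr1 Num.norm).
  by rewrite normrX normr1 => /eqP; rewrite pexpr_eq1 // => /eqP.
have u1 : `|z ^+ k| = 1 by rewrite normrX z1 expr1n.
rewrite invC_norm u1 expr1n invr1 mul1r -real_ler_norml.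
  by rewrite (le_trans (ler_normD _ _)) // norm_conjC u1.
by apply/CrealP; rewrite rmorphD /= conjCK addrC.
Qed.

Lemma Psi_intr m : (2 < m)%N -> exists2 z : algC, m.-primitive_root z &
  forall s : int, ((Psi m).[s])%:~R =
    \prod_(k < m | coprime k m && (k.*2 < m)%N) (s%:~R - (z ^+ k + z ^- k)) :>
      algC.
Proof.
move=> m2; have [z zP E] := Psi_tr_min m2; exists z => // s.
rewrite -horner_map /= E horner_prod; apply: eq_bigr => k _.
by rewrite hornerXsubC.
Qed.

Lemma Psi_sqr_intr m : (0 < m)%N -> exists2 z : algC, m.-primitive_root z &
  forall s : int, ((Psi_sqr m).[s])%:~R =
    \prod_(k < m | coprime k m) (s%:~R - (z ^+ k + z ^- k)) :> algC.
Proof.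
move=> m0; have [z zP] := C_prim_root_exists m0; exists z => // s.
rewrite -horner_map /= (Psi_sqrE zP) horner_prod; apply: eq_bigr => k _.
by rewrite hornerXsubC.
Qed.

Lemma Psi_lt m (a b : int) : (2 < m)%N -> 2 <= a -> a < b ->
  (Psi m).[a] < (Psi m).[b].
Proof.
move=> m2 a2 ab; have [z zP E] := Psi_intr m2.
rewrite -(ltr_int algC) !E; apply: ltr_prod.
  apply/hasP; exists (Ordinal (ltnW m2)); rewrite ?mem_index_enum //=.
  by rewrite coprime1n m2.
move=> k _; have /andP[_ h] := trace_root_bound k zP.
rewrite ltrD2r ltr_int ab andbT subr_ge0 (le_trans h) //.
by rewrite -[2]/(2%:~R) ler_int.
Qed.

Definition Psi_deg m := #|[pred k : 'I_m | coprime k m && (k.*2 < m)%N]|.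

Lemma Psi_ge m (s : int) : (2 < m)%N -> 2 <= s ->
  (s - 2) ^+ Psi_deg m <= (Psi m).[s].
Proof.
move=> m2 s2; have [z zP E] := Psi_intr m2.
rewrite -(ler_int algC) E rmorphXn rmorphB /= -prodr_const.
apply: ler_prod => k _; have /andP[_ h] := trace_root_bound k zP.
by rewrite lerD2l lerN2 h subr_ge0 -[2]/(2%:~R) ler_int s2.
Qed.

Lemma Psi_gt0 m (s : int) : (2 < m)%N -> 3 <= s -> 0 < (Psi m).[s].
Proof.
move=> m2 s3; apply: lt_le_trans (Psi_ge m2 _); last by lia.
by rewrite exprn_gt0 //; lia.
Qed.

Lemma Psi_sqr_ge m (s : int) : (0 < m)%N -> 2 <= s ->
  (s - 2) ^+ totient m <= (Psi_sqr m).[s].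
Proof.
move=> m0 s2; have [z zP E] := Psi_sqr_intr m0.
rewrite -(ler_int algC) E rmorphXn rmorphB /= -card_coprime -prodr_const.
apply: ler_prod => k _; have /andP[_ h] := trace_root_bound k zP.
by rewrite lerD2l lerN2 h subr_ge0 -[2]/(2%:~R) ler_int s2.
Qed.

Lemma Psi_sqr_le m (s : int) : (0 < m)%N -> 2 <= s ->
  (Psi_sqr m).[s] <= (s + 2) ^+ totient m.
Proof.
move=> m0 s2; have [z zP E] := Psi_sqr_intr m0.
rewrite -(ler_int algC) E rmorphXn rmorphD /= -card_coprime -prodr_const.
apply: ler_prod => k _; have /andP[h' h] := trace_root_bound k zP.
rewrite lerD2l lerNl h' subr_ge0 andbT (le_trans h) //.
by rewrite -[2]/(2%:~R) ler_int.
Qed.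

Lemma Psi_sqr_gt0 m (s : int) : (0 < m)%N -> 3 <= s -> 0 < (Psi_sqr m).[s].
Proof.
move=> m0 s3; apply: lt_le_trans (Psi_sqr_ge m0 _); last by lia.
by rewrite exprn_gt0 //; lia.
Qed.

Lemma Psi_sqr_gt2 m (s : int) : (2 < m)%N -> (Psi_sqr m).[s] = (Psi m).[s] ^+ 2.
Proof.
by move=> m2; rewrite /Psi_sqr !gtn_eqF ?horner_exp // ltnW.
Qed.

(** A second index besides k = 1, so that Psi_m is not linear. The witness is 2 for m odd, m/2 - 1
    for m divisible by 4, and m/2 - 2 for m = 2 modulo 4; in the last two cases it is odd and m is
    twice it plus 2 or 4. *)
Lemma coprime_lt_half m : (2 < m)%N -> m \notin [:: 3; 4; 6]%N ->
  exists k, [/\ (1 < k)%N, (k.*2 < m)%N & coprime k m].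
Proof.
move=> m2; rewrite !inE !negb_or => /and3P[m3 m4 m6].
have : (exists q, m = q.*2.+1) \/ (exists q, m = (4 * q)%N) \/ (exists q, m =
  (4 * q + 2)%N).
  have := odd_double_half m; case: (odd m) => E; first by left; exists m./2;
    lia.
  right; have := odd_double_half m./2; case: (odd m./2) => F.
    by right; exists m./2./2; lia.
  by left; exists m./2./2; lia.
move=> [[q E]|[[q E]|[q E]]].
- by exists 2; split; [lia | lia | rewrite coprime2n E /= odd_double].
- exists q.*2.-1; split; [lia | lia |].
  have -> : (m = 2 * q.*2.-1 + 2)%N by lia.
  rewrite /coprime gcdnMDl -/(coprime _ _) coprimen2.
  have -> : q.*2.-1 = q.-1.*2.+1 by lia.
  by rewrite /= odd_double.
- exists q.*2.-1; split; [lia | lia |].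
  have -> : (m = 2 * q.*2.-1 + 2 ^ 2)%N by lia.
  rewrite /coprime gcdnMDl -/(coprime _ _) coprimeXr // coprimen2.
  have -> : q.*2.-1 = q.-1.*2.+1 by lia.
  by rewrite /= odd_double.
Qed.

Lemma Psi_deg_gt1 m : (2 < m)%N -> m \notin [:: 3; 4; 6]%N -> (1 < Psi_deg m)%N.
Proof.
move=> m2 mN; have [k [k1 k2 ck]] := coprime_lt_half m2 mN.
have km : (k < m)%N by lia.
rewrite /Psi_deg (cardD1 (Ordinal km)) inE /= ck k2 /=.
rewrite (cardD1 (Ordinal (ltnW m2))) !inE /= coprime1n m2 andbT.
have -> : Ordinal (ltnW m2) != Ordinal km by rewrite -val_eqE /=; lia.
by [].
Qed.

(** From 3 to 4 every factor a_k >= 1 becomes 1 + a_k. Expanding the factor of index 1 adds the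
    product of the other new factors, which is at least 2 because another index exists. *)
Lemma Psi_gap m : (2 < m)%N -> m \notin [:: 3; 4; 6]%N ->
  (Psi m).[3] + 2 <= (Psi m).[4].
Proof.
move=> m2 mN; have [k [k1 k2 ck]] := coprime_lt_half m2 mN.
have km : (k < m)%N by lia.
have [z zP E] := Psi_intr m2; pose a j : algC := 3 - (z ^+ j + z ^- j).
have a1 j : 1 <= a j.
  have /andP[_ h] := trace_root_bound j zP.
  have e3 : 1 + 2 = 3 :> algC by ring.
  by rewrite /a lerBrDr -e3 lerD2l.
have E3 : ((Psi m).[3])%:~R = \prod_(k < m | coprime k m && (k.*2 < m)%N) a k.
  exact: E.
have E4 : ((Psi m).[4])%:~R =
    \prod_(k < m | coprime k m && (k.*2 < m)%N) (1 + a k).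
  by rewrite E; apply: eq_bigr => j _; rewrite /a; ring.
clearbody a; have a0 j : 0 <= a j := le_trans ler01 (a1 j).
have c1 : coprime 1 m && (2 < m)%N by rewrite coprime1n m2.
rewrite -(ler_int algC) rmorphD /= E3 E4 (bigD1 (Ordinal (ltnW m2))) //=.
rewrite [X in _ <= X](bigD1 (Ordinal (ltnW m2))) //= mulrDl mul1r addrC.
apply: lerD.
  rewrite (bigD1 (Ordinal km)) /=; last first.
    by rewrite ck k2 -val_eqE /=; lia.
  rewrite -[leLHS]mulr1; apply: ler_pM => //.
    by have := a1 k; rewrite -(lerD2l 1).
  apply: (big_rec (fun x => 1 <= x)) => [//|j x _ x1].
  by rewrite -[leLHS]mulr1; apply: ler_pM => //; rewrite lerDl.
apply: ler_wpM2l => //; apply: ler_prod => j _.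
by rewrite a0 lerDr ler01.
Qed.

Lemma Psi_linear m : m \in [:: 3; 4;
  6]%N -> exists c, forall s, (Psi m).[s] = s + c.
Proof.
move=> mN; have m2 : (2 < m)%N by move: mN; rewrite !inE; lia.
have [z zP E] := Psi_intr m2.
have [w wE] : exists w : algC, forall s : int, ((Psi m).[s])%:~R = s%:~R - w.
  exists (z ^+ 1 + z ^- 1) => s; rewrite E -[RHS]mulr1.
  rewrite (bigD1 (Ordinal (ltnW m2))) /=; last by rewrite coprime1n m2.
  congr (_ * _); apply: big1 => k /andP[/andP[ck k2]]; rewrite -val_eqE /=.
  move: (nat_of_ord k) ck k2 => {}k ck k2 k1; exfalso; move: mN ck k2 k1.
  by rewrite !inE => /or3P[]/eqP ->; case: k => [|[|[|k]]].
exists ((Psi m).[0]) => s; apply: (intr_inj (R := algC)).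
by rewrite rmorphD /= !wE add0r.
Qed.

(** * Ranks of apparition *)

(** With s = x + 1/x over an algebraic closure of F_p, a is the multiplicative order of x, since
    V_k(s) - 2 = (x^k - 1)^2 / x^k. *)
Definition is_rank (s : int) (p a : nat) : Prop :=
  (0 < a)%N /\ forall k, (p%:Z %| lucV s k - 2)%Z = (a %| k)%N.

Lemma dvdzDl_iff (d a b : int) : (d %| b)%Z -> (d %| a + b)%Z = (d %| a)%Z.
Proof. exact: rpredDr. Qed.

Lemma dvdz_prod_seq (p : nat) (I : eqType) (r : seq I) (F : I ->
  int) : prime p ->
  (p%:Z %| \prod_(i <- r) F i)%Z -> exists2 i, i \in r & (p%:Z %| F i)%Z.
Proof.
move=> pp; elim: r => [|i r IH].
  by rewrite big_nil dvdz1 /= => /eqP p1; rewrite p1 in pp.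
rewrite big_cons Euclid_dvdzM // => /orP[h|/IH[j jr h]].
  by exists i; rewrite ?mem_head.
by exists j; rewrite // inE jr orbT.
Qed.

Lemma lucV_growth (s : int) n : 3 <= s ->
  [/\ 2 <= lucV s n, lucV s n <= lucV s n.+1 & 2 * lucV s n.+1 <= lucV s n.+2].
Proof.
move=> s3; elim: n => [|n [IH0 IH1 IH2]]; first by split=> //=; nia.
by split; [lia | lia | rewrite (lucVSS s n.+1); nia].
Qed.

Lemma lucV_double (s : int) n : 3 <= s -> (0 < n)%N ->
  2 * lucV s n <= lucV s n.+1.
Proof. by case: n => // n s3 _; have [] := lucV_growth n s3. Qed.

Lemma lucV_ge3 (s : int) n : 3 <= s -> (0 < n)%N -> 3 <= lucV s n.
Proof.
move=> s3; elim: n => // n IH _; have [->|n0] := posnP n; first by [].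
by have := lucV_double s3 n0; have := IH n0; lia.
Qed.

Lemma lucV_lt (s : int) n k : 3 <= s -> (n < k)%N -> lucV s n < lucV s k.
Proof.
move=> s3; elim: k => // k IH; rewrite ltnS leq_eqVlt => /orP[/eqP <-|nk].
  have [->|n0] := posnP n; first by rewrite /=; lia.
  by have := lucV_double s3 n0; have := lucV_ge3 s3 n0; lia.
have k0 : (0 < k)%N by lia.
by apply: lt_trans (IH nk) _; have := lucV_double s3 k0;
  have := lucV_ge3 s3 k0; lia.
Qed.

Lemma lucV_sub2_neq0 (s : int) n : 3 <= s -> (0 < n)%N -> lucV s n - 2 != 0.
Proof. by move=> s3 n0; have := lucV_ge3 s3 n0; lia. Qed.

Lemma Psi_sqr_dvd (s : int) m : (0 < m)%N ->
  ((Psi_sqr m).[s] %| lucV s m - 2)%Z.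
Proof.
move=> m0; rewrite prod_Psi_sqr // (big_rem m) ?dvdz_mulr //=.
by rewrite -dvdn_divisors.
Qed.

Lemma Psi_sqr_dvd_quo (s : int) q n : (1 < q)%N -> (0 < n)%N -> exists c,
  lucV s (q * n) - 2 = (lucV s n - 2) * (Psi_sqr (q * n)).[s] * c.
Proof.
move=> q1 n0; have m0 : (0 < q * n)%N by rewrite muln_gt0 ltnW.
rewrite !prod_Psi_sqr // (bigID (fun d => d %| n)%N) /=.
rewrite -big_filter -[X in _ * X]big_filter.
have -> : \prod_(i <- [seq d <- divisors (q * n) | (d %| n)%N]) (Psi_sqr
  i).[s] =
    \prod_(d <- divisors n) (Psi_sqr d).[s].
  apply: perm_big; apply: uniq_perm;
    rewrite ?filter_uniq ?divisors_uniq // => d.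
  rewrite mem_filter -!dvdn_divisors //.
  by case: (boolP (d %| n)%N) => //= dn; rewrite dvdn_mull.
rewrite [X in _ * X](big_rem (q * n)) /=; last first.
  rewrite mem_filter -dvdn_divisors // dvdnn andbT.
  by apply/negP => /(dvdn_leq n0); nia.
by eexists; rewrite mulrA.
Qed.

(** As F_m divides V_m - 2, a divides m. If a prime q divides m/a, put n = m/q: p divides V_n - 2,
    and F_m divides (V_m - 2)/(V_n - 2), which is congruent to q^2 modulo V_n - 2. Hence q = p. *)
Lemma rank_Psi_sqr s p a m : prime p -> 3 <= s -> is_rank s p a -> (0 < m)%N ->
  (p%:Z %| (Psi_sqr m).[s])%Z -> exists j, m = (a * p ^ j)%N.
Proof.
move=> pp s3 [a0 aP] m0 pm.
have am : (a %| m)%N by rewrite -aP (dvdz_trans pm) ?Psi_sqr_dvd.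
have /dvdnP[r mE] := am; rewrite mulnC in mE.
suff /p_natP[j rE] : p.-nat r by exists j; rewrite mE rE.
apply/pnatP; first by move: m0; rewrite mE muln_gt0 => /andP[].
move=> q pq /dvdnP[r' rE]; rewrite inE /=.
have n0 : (0 < a * r')%N by move: m0; rewrite mE rE !muln_gt0 a0 /= => /andP[].
have mE' : m = (q * (a * r'))%N by rewrite mE rE; lia.
have [c E] := Psi_sqr_dvd_quo s (prime_gt1 pq) n0.
have [z E'] := lucV_sub2_factor (lucV s (a * r')) q.
rewrite lucV_comp [(_ * q)%N]mulnC -mE' in E'; rewrite -mE' E' -mulrA in E.
have w0 := lucV_sub2_neq0 s3 n0.
have {}E := mulfI w0 E.
have : (p%:Z %| q%:Z ^+ 2)%Z.
  have pw : (p%:Z %| lucV s (a * r') - 2)%Z by rewrite aP dvdn_mulr.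
  have : (p%:Z %| q%:Z ^+ 2 + (lucV s (a * r') - 2) * z)%Z
    by rewrite E dvdz_mulr.
  by rewrite (dvdzDl_iff _ (dvdz_mulr z pw)).
by rewrite Euclid_dvdzX // dvdzE /= dvdn_prime2 // eq_sym.
Qed.

Lemma rank_dvd_Psi_sqr s p a : prime p -> is_rank s p a ->
  (p%:Z %| (Psi_sqr a).[s])%Z.
Proof.
move=> pp [a0 aP]; have : (p%:Z %| lucV s a - 2)%Z by rewrite aP.
rewrite prod_Psi_sqr // => /dvdz_prod_seq[//|d];
  rewrite -dvdn_divisors // => da pd.
suff -> : a = d by [].
have d0 := dvdn_gt0 a0 da.
by apply/eqP; rewrite eqn_dvd da andbT -aP (dvdz_trans pd) ?Psi_sqr_dvd.
Qed.

Lemma rank_eq_Psi_sqr s p a m : prime p -> 3 <= s -> is_rank s p a ->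
  (0 < m)%N ->
  ~~ (p %| m)%N -> (p%:Z %| (Psi_sqr m).[s])%Z = (a == m).
Proof.
move=> pp s3 ra m0 pm; apply/idP/eqP => [h|<-]; last exact: rank_dvd_Psi_sqr.
have [[|j] E] := rank_Psi_sqr pp s3 ra m0 h; first by rewrite E muln1.
by move: pm; rewrite E expnS mulnCA dvdn_mulr.
Qed.

(** The order of the power x^k, when x has order a. *)
Lemma is_rank_lucV s p a k : is_rank s p a -> (0 < k)%N ->
  is_rank (lucV s k) p (a %/ gcdn a k).
Proof.
move=> [a0 aP] k0; have g0 : (0 < gcdn a k)%N by rewrite gcdn_gt0 a0.
split; first by rewrite divn_gt0 // dvdn_leq // dvdn_gcdl.
move=> j; rewrite lucV_comp aP.
have -> : (a %| k * j)%N = (a %| gcdn (a * j) (k * j))%N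
  by rewrite dvdn_gcd (dvdn_mulr j (dvdnn a)).
by rewrite -muln_gcdl -{1}(divnK (dvdn_gcdl a k)) mulnC dvdn_pmul2l.
Qed.

Lemma logn_lucV_Psi_sqr s p m : prime p -> 3 <= s -> is_rank s p m ->
  ~~ (p %| m)%N -> logn p `|lucV s m - 2| = logn p `|(Psi_sqr m).[s]|.
Proof.
move=> pp s3 rm pm; have [m0 mP] := rm.
rewrite prod_Psi_sqr // (big_rem m) /=; last by rewrite -dvdn_divisors.
have nz d : d \in rem m (divisors m) -> [/\ d != m, (0 < d)%N & (d %| m)%N].
  rewrite mem_rem_uniq ?divisors_uniq // !inE -dvdn_divisors // => /andP[dm
    dvm].
  by split=> //; apply: dvdn_gt0 dvm.
have fm0 : (Psi_sqr m).[s] != 0 by rewrite gt_eqF ?Psi_sqr_gt0.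
set Q := \prod_(d <- _) _.
have pQ : ~~ (p%:Z %| Q)%Z.
  apply/negP => /dvdz_prod_seq[//|d /nz[dm d0 dvm]].
  rewrite (rank_eq_Psi_sqr pp s3 rm) //; first by rewrite eq_sym (negPf dm).
  by apply: contra pm => /dvdn_trans; apply.
have Q0 : Q != 0 by apply: contra pQ => /eqP ->; rewrite dvdz0.
rewrite abszM lognM ?absz_gt0 // (lognE p `|Q|) ?[X in (_ + X)%N]ifF ?addn0 //.
by rewrite dvdzE in pQ; rewrite (negPf pQ) !andbF.
Qed.

(* The last hypothesis excludes [p = 3] and [w = 6], where
   [lucV 8 3 - 2 = 6 * 3 ^ 4]. *)
Lemma lucV_prime_val (w : int) p : prime p -> (2 < p)%N -> (p%:Z %| w)%Z ->
  (4 < p)%N || (p%:Z ^+ 2 %| w)%Z ->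
  exists2 u, lucV (w + 2) p - 2 = w * (p%:Z ^+ 2 * u) & ~~ (p%:Z %| u)%Z.
Proof.
move=> pp p2 /dvdzP[w' wE] hw.
have [b [c [d [E Eb Ec]]]] := lucV_expand w p.
have pN3 k : (3 < p)%N -> (p%:Z ^+ 2 %| 12 * k)%Z -> (p%:Z ^+ 2 %| k)%Z.
  move=> p3; rewrite Gauss_dvdzr // coprimezXl //.
  rewrite (_ : 12 = (2 * 2 * 3)%N%:Z) // coprimezE !absz_nat prime_coprime //.
  rewrite !Euclid_dvdM //.
  by rewrite !dvdn_prime2 // !orbb !gtn_eqF // ltnW.
have suffu u' : lucV (w + 2) p - 2 = w * (p%:Z ^+ 2 * (1 + p%:Z * u')) ->
  exists2 u, lucV (w + 2) p - 2 = w * (p%:Z ^+ 2 * u) & ~~ (p%:Z %| u)%Z.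
  move=> H; exists (1 + p%:Z * u') => //;
    rewrite (dvdzDl_iff _ (dvdz_mulr u' (dvdzz p))).
  by rewrite dvdz1 /=; apply: contraL pp => /eqP ->.
(* If p^2 divides w, it is enough that p divides b, which for p = 3 is 9 . 8 / 12 = 6. *)
case: (boolP (p%:Z ^+ 2 %| w)%Z) hw => [/dvdzP[w2 w2E] _|_].
  have [b' bE] : exists b', b = p%:Z * b'.
    have [p3|p3] := leqP p 3.
      have p3E : p = 3 by lia.
      by exists 2; move: Eb; rewrite p3E; lia.
    have /dvdzP[b' ->] : (p%:Z ^+ 2 %| b)%Z.
      by apply: pN3 => //; rewrite Eb dvdz_mulr.
    by exists (p%:Z * b'); ring.
  apply: (suffu (w2 * (b' + w2 * p%:Z * (c + w * d)))); rewrite E bE w2E; ring.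
(* Now w may contain p only once, so p^2 | b and p | c are both wanted. *)
rewrite orbF => p4.
have /dvdzP[b' bE] : (p%:Z ^+ 2 %| b)%Z.
  by apply: pN3; [apply: ltnW | rewrite Eb dvdz_mulr].
have [c' cE] : exists c', c = p%:Z * c'.
  suff : (p%:Z %| 72 * c)%Z.
    rewrite Gauss_dvdzr.
      by move=> /dvdzP[c' ->]; exists c'; ring.
    rewrite (_ : 72 = (2 ^ 3 * 3 ^ 2)%N%:Z) // coprimezE !absz_nat
      prime_coprime //.
    rewrite Euclid_dvdM // !Euclid_dvdX // !dvdn_prime2 // !gtn_eqF //; lia.
  (* As 360 = 5 . 72, the 5 cannot be cancelled for p = 5; there c = 25 . 24 . 21 / 360 = 35. *)
  have [p5|p5] := eqVneq p 5; first by move: Ec; rewrite p5 => Ec;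
    apply/dvdzP; exists (7 * 72%:Z); lia.
  have : (p%:Z %| 5 * (72 * c))%Z.
    have -> : 5 * (72 * c) = 360 * c by ring.
    by rewrite Ec expr2 -!mulrA dvdz_mulr.
  rewrite Euclid_dvdzM // => /orP[|//].
  by rewrite dvdzE /= dvdn_prime2 // (negPf p5).
apply: (suffu (w' * (b' + c' * w' + w' ^+ 2 * d))).
by rewrite E bE cE wE; ring.
Qed.

(** Each factor p of l contributes p^2 by [lucV_prime_val], through V_(p l') (s) = V_l'(V_p(s)); for
    l prime to p the quotient by s - 2 is l^2 modulo p. The divisibility of s - 2 by p^2 covers p =
    3 and passes on to V_p(s) - 2. *)
Lemma logn_lucV_mul (s : int) p l : prime p -> (2 < p)%N -> (0 < l)%N ->
  3 <= s ->
  (p%:Z ^+ 2 %| s - 2)%Z ->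
  logn p `|lucV s l - 2| = (logn p `|s - 2|%N + 2 * logn p l)%N.
Proof.
move=> pp p2; elim/ltn_ind: l s => l IH s l0 s3 ps.
have w0 : s - 2 != 0 by lia.
have pw : (p%:Z %| s - 2)%Z by apply: dvdz_trans ps; rewrite expr2 dvdz_mulr.
have notp u : ~~ (p%:Z %| u)%Z -> logn p `|u| = 0%N.
  by rewrite dvdzE /= => /negPf h; rewrite lognE h !andbF.
have nz u : ~~ (p%:Z %| u)%Z -> u != 0.
  by apply: contra => /eqP ->; rewrite dvdz0.
have [/dvdnP[l' lE]|pl] := boolP (p %| l)%N; last first.
  have [z ->] := lucV_sub2_factor s l.
  have pu : ~~ (p%:Z %| l%:Z ^+ 2 + (s - 2) * z)%Z.
    by rewrite (dvdzDl_iff _ (dvdz_mulr z pw)) Euclid_dvdzX.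
  rewrite abszM lognM ?absz_gt0 ?w0 ?(nz _ pu) // (notp _ pu).
  by rewrite (lognE p l) (negPf pl) !andbF muln0.
have l'0 : (0 < l')%N by move: l0; rewrite lE muln_gt0 => /andP[].
have [u E pu] := lucV_prime_val pp p2 pw (introT orP (or_intror ps)).
rewrite subrK in E.
have l'l : (l' < l)%N by rewrite lE; move: (prime_gt1 pp); nia.
have p3 := lucV_ge3 s3 (prime_gt0 pp).
have pp2 : (p%:Z ^+ 2 %| lucV s p - 2)%Z by rewrite E dvdz_mull // dvdz_mulr.
rewrite lE mulnC -lucV_comp (IH _ l'l) //.
rewrite E lognM ?(prime_gt0 pp) // (logn_prime p pp) eqxx abszM (abszM _ u)
  abszX.
have p0 : p%:Z != 0 by rewrite -absz_gt0 (prime_gt0 pp).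
rewrite !lognM ?muln_gt0 ?expn_gt0 ?absz_gt0 ?w0 ?(nz _ pu) ?p0 //.
rewrite ?lognX !absz_nat !(logn_prime p pp) eqxx (notp _ pu) /=.
by move: (logn p _) => v; lia.
Qed.

Lemma prod_divisors_pow (R : Type) (idx : R) (op : Monoid.com_law idx)
    (F : nat -> R) p b m : prime p -> (0 < m)%N -> ~~ (p %| m)%N ->
  \big[op/idx]_(d <- divisors (p ^ b.+1 * m)) F d =
  op (\big[op/idx]_(d <- divisors (p ^ b * m)) F d)
     (\big[op/idx]_(d <- divisors m) F (p ^ b.+1 * d)%N).
Proof.
move=> pp m0 pm; have pb c : (0 < p ^ c)%N by rewrite expn_gt0 prime_gt0.
rewrite -(big_map (fun d => p ^ b.+1 * d)%N xpredT F) -big_cat /=.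
apply: perm_big; apply: uniq_perm; first exact: divisors_uniq.
  rewrite cat_uniq divisors_uniq map_inj_uniq ?divisors_uniq ?andbT /=;
    last first.
    by move=> x y /eqP; rewrite eqn_pmul2l // => /eqP.
  apply/hasPn => _ /mapP[d dm ->]; rewrite -dvdn_divisors ?muln_gt0 ?pb //.
  rewrite expnSr -mulnA dvdn_pmul2l //; apply: contra pm => h.
  by apply: dvdn_trans h; apply: dvdn_mulr.
move=> d; rewrite mem_cat -!dvdn_divisors ?muln_gt0 ?pb //.
apply/idP/orP => [dn|[dn|/mapP[e]]]; last first.
- by rewrite -dvdn_divisors // => em ->; rewrite dvdn_pmul2l.
- by apply: dvdn_trans dn _; rewrite expnS -mulnA dvdn_mull.
have d0 : (0 < d)%N by apply: dvdn_gt0 dn; rewrite muln_gt0 pb.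
have [dE|] := boolP (p ^ b.+1 %| d)%N.
  right; have /dvdnP[e eE] := dE; rewrite mulnC in eE; apply/mapP;
    exists e => //.
  by rewrite -dvdn_divisors // -(dvdn_pmul2l (pb b.+1)) -eE.
rewrite pfactor_dvdn // -ltnNge ltnS => lb; left.
have [e [pe dE]] : exists e, ~~ (p %| e)%N /\ d = (e * p ^ logn p d)%N.
  have [e pe dE] := pfactor_coprime pp d0; exists e; split=> //.
  by rewrite -prime_coprime.
rewrite dE mulnC dvdn_mul ?dvdn_exp2l //.
have : (e %| p ^ b.+1 * m)%N by apply: dvdn_trans dn; rewrite dE dvdn_mulr.
by rewrite Gauss_dvdr // coprime_sym coprimeXl // prime_coprime.
Qed.

(** The counterpart of Phi_(p^(b+1) m)(x) Phi_m(x^(p^b)) = Phi_m(x^(p^(b+1))). Induction on m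
    cancels the factors of its proper divisors. *)
Lemma Psi_sqr_pow (s : int) p b m : prime p -> 3 <= s -> (0 < m)%N ->
  ~~ (p %| m)%N ->
  (Psi_sqr (p ^ b.+1 * m)).[s] * (Psi_sqr m).[lucV s (p ^ b)] =
  (Psi_sqr m).[lucV s (p ^ b.+1)].
Proof.
move=> pp s3; elim/ltn_ind: m => m IH m0 pm.
have pb c : (0 < p ^ c)%N by rewrite expn_gt0 prime_gt0.
have := prod_divisors_pow *%R (fun d => (Psi_sqr d).[s]) b pp m0 pm.
rewrite /= -!prod_Psi_sqr ?muln_gt0 ?pb // -!lucV_comp !prod_Psi_sqr //.
have md : m \in divisors m by rewrite -dvdn_divisors.
rewrite !(big_rem m md) /=.
set A := \prod_(d <- _) _; set B := \prod_(d <- _) _; set C := \prod_(d <- _) _.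
have AE : A = C * B.
  rewrite /A /B /C -big_split /=; apply: eq_big_seq => d.
  rewrite mem_rem_uniq ?divisors_uniq // !inE -dvdn_divisors // => /andP[dm
    dvm].
  rewrite IH //; first by rewrite ltn_neqAle dm dvdn_leq.
    by apply: dvdn_gt0 dvm.
  by apply: contra pm => /dvdn_trans; apply.
have A0 : A != 0.
  have := lucV_sub2_neq0 (lucV_ge3 s3 (pb b.+1)) m0.
  by rewrite prod_Psi_sqr // (big_rem m md) /= -/A mulf_eq0 negb_or => /andP[].
move=> E; apply: (mulIf A0); rewrite E AE; ring.
Qed.

(** * Lower bounds for F_n when p divides n *)

Lemma totient_ge2 m : (2 < m)%N -> (2 <= totient m)%N.
Proof.
move=> m2; have m1 : (m.-1 < m)%N by lia.
rewrite -card_coprime (cardD1 (Ordinal m1)) (cardD1 (Ordinal (ltnW m2))) !inE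
  /=.
rewrite coprime1n coprimePn ?(ltnW (ltnW m2)) //.
by have -> : Ordinal (ltnW m2) != Ordinal m1 by rewrite -val_eqE /=; lia.
Qed.

Lemma totient_ge3 m : (2 < m)%N -> m \notin [:: 3; 4;
  6]%N -> (3 <= totient m)%N.
Proof.
move=> m2 mN; have [k [k1 k2 ck]] := coprime_lt_half m2 mN.
have m1 : (m.-1 < m)%N by lia.
have km : (k < m)%N by lia.
rewrite -card_coprime (cardD1 (Ordinal m1)) (cardD1 (Ordinal (ltnW m2))).
rewrite (cardD1 (Ordinal km)) !inE /= coprime1n coprimePn ?(ltnW (ltnW m2)) //
  ck.
have -> : Ordinal (ltnW m2) != Ordinal m1 by rewrite -val_eqE /=; lia.
have -> : Ordinal km != Ordinal m1 by rewrite -val_eqE /=; lia.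
by have -> : Ordinal km != Ordinal (ltnW m2) by rewrite -val_eqE /=; lia.
Qed.

(** Supplies c = p^2 + 1 in [Psi_sqr_lower] for p >= 7. Doubling gives V_7 >= 16 V_3 >= 96 s, more
    than 50 (s + 2) + 2; afterwards V_n at least doubles at each step, and n^2 + 1 does not. *)
Lemma lucV_lower (s : int) n : 3 <= s -> (6 < n)%N ->
  (n%:Z ^+ 2 + 1) * (s + 2) <= lucV s n - 2.
Proof.
move=> s3; elim: n => // n IH; rewrite ltnS leq_eqVlt => /orP[/eqP <-|n6].
  have h6 := lucV_double s3 (isT : 0 < 6)%N.
  have h5 := lucV_double s3 (isT : 0 < 5)%N.
  have h4 := lucV_double s3 (isT : 0 < 4)%N.
  have h3 := lucV_double s3 (isT : 0 < 3)%N.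
  have : 6 * s <= lucV s 3 by rewrite /=; nia.
  by move: (lucV s 7) (lucV s 6) (lucV s 5) (lucV s 4) (lucV s 3) h6 h5 h4 h3
    => *; lia.
have h := lucV_double s3 (ltnW (ltnW (ltnW (ltnW (ltnW (ltnW n6)))))).
have {}IH := IH n6; have -> : n.+1%:Z = n%:Z + 1 by lia.
move: (lucV s n) (lucV s n.+1) IH h.
move=> a c IH h; have n6' : 6 < n%:Z by lia.
move: (n%:Z) n6' IH => N N6 IH.
have : 0 <= (N * (N - 2)) * (s + 2) by rewrite !mulr_ge0 //; lia.
by move: IH; rewrite !expr2; nia.
Qed.

(** By [Psi_sqr_pow] the value is a quotient of two values of F_m, at V_(p^(b+1)) and at V_(p^b).
    Bounding these below and above by powers of exponent phi(m) leaves the ratio c. *)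
Lemma Psi_sqr_lower (s : int) p b m (c : int) : prime p -> 3 <= s ->
  (0 < m)%N ->
  ~~ (p %| m)%N -> 0 <= c ->
  c * (lucV s (p ^ b) + 2) <= lucV (lucV s (p ^ b)) p - 2 ->
  c ^+ totient m <= (Psi_sqr (p ^ b.+1 * m)).[s].
Proof.
move=> pp s3 m0 pm c0 h;
  have pb e : (0 < p ^ e)%N by rewrite expn_gt0 prime_gt0.
have sb := lucV_ge3 s3 (pb b); have sb1 := lucV_ge3 s3 (pb b.+1).
have f0 : 0 < (lucV s (p ^ b) + 2) ^+ totient m by rewrite exprn_gt0 //; lia.
rewrite -(ler_pM2r f0) -exprMn.
apply: le_trans (_ : (lucV s (p ^ b.+1) - 2) ^+ totient m <= _).
  apply: lerXn2r; rewrite ?nnegrE ?mulr_ge0 //; [lia|lia|].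
  by rewrite expnSr -lucV_comp.
apply: le_trans (Psi_sqr_ge m0 _) _; first by lia.
rewrite -Psi_sqr_pow // ler_pM2l; first by apply: Psi_sqr_le; lia.
by apply: Psi_sqr_gt0 => //; rewrite muln_gt0 pb.
Qed.

Lemma lucV_le (s : int) n k : 3 <= s -> (n <= k)%N -> lucV s n <= lucV s k.
Proof.
move=> s3; rewrite leq_eqVlt => /orP[/eqP -> //|nk]; exact/ltW/lucV_lt.
Qed.

Lemma Psi_sqr_gt_prime (s : int) p n : prime p -> 3 <= s -> (12 < n)%N ->
  (p %| n)%N ->
  (2 < p)%N || (8 %| n)%N -> p%:Z ^+ 2 < (Psi_sqr n).[s].
Proof.
move=> pp s3 n12 pn hp; have n0 : (0 < n)%N by lia.
have [m pm nE] := pfactor_coprime pp n0.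
have pm' : ~~ (p %| m)%N by rewrite -prime_coprime.
have m0 : (0 < m)%N by move: n0; rewrite nE muln_gt0 => /andP[].
have l0 : (0 < logn p n)%N by rewrite logn_gt0 mem_primes pp n0.
have [b lE] : exists b, logn p n = b.+1 by exists (logn p n).-1; rewrite prednK.
rewrite lE mulnC in nE; have t0 : (0 < totient m)%N by rewrite totient_gt0.
have pb e : (0 < p ^ e)%N by rewrite expn_gt0 prime_gt0.
have sb := lucV_ge3 s3 (pb b).
have low := Psi_sqr_lower pp s3 m0 pm'.
have cge (c : int) k : 1 <= c -> (k <= totient m)%N -> c ^+ k <= c ^+ totient m.
  by move=> c1 kt; apply: ler_weXn2l.
rewrite nE.
have [p7|p7] := ltnP 6 p.
  apply: lt_le_trans (low b (p%:Z ^+ 2 + 1) _ _); last exact: lucV_lower.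
    have c1 : 1 <= p%:Z ^+ 2 + 1 by rewrite lerDr sqr_ge0.
    by apply: lt_le_trans (cge _ _ c1 t0); rewrite expr1 ltrDl.
  by rewrite addr_ge0 ?sqr_ge0.
have : p \in [:: 2; 3; 5]%N.
  by case: p pp p7 {pn hp pm nE pm' l0 lE pb sb low} => [|[|[|[|[|[|[|]]]]]]].
rewrite !inE => /or3P[]/eqP pE;
  rewrite {}pE in pp pn hp pm nE pm' l0 lE pb sb low p7 *.
- have b2 : (1 < b)%N.
    by move: hp; rewrite /= -[8%N]/(2 ^ 3)%N pfactor_dvdn // lE.
  (* 47 is V_4(3). The ratio is v - 2, as V_2(v) - 2 = (v - 2)(v + 2), which leaves room for c = 5 >
     2^2. *)
  have s47 : 47 <= lucV s (2 ^ b).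
    apply: le_trans (lucV_le s3 (_ : 4 <= 2 ^ b)%N);
      last by rewrite -[4%N]/(2 ^ 2)%N leq_exp2l.
    by rewrite /=; nia.
  apply: lt_le_trans (low b 5 _ _) => //.
    by apply: lt_le_trans (cge _ _ _ t0).
  by move: (lucV s (2 ^ b)) s47 {sb} => v /=; nia.
- have [b0|b0] := posnP b.
    (* At s = 3 the ratio is 16/5, so c = 3 and an exponent of at least 3 is required. Since 3 m >
       12 and 3 does not divide m, m is none of 3, 4, 6. *)
    move: nE low {sb lE}; rewrite b0 => nE low.
    have m4 : (4 < m)%N by lia.
    have m6 : m != 6%N by apply: contra pm' => /eqP ->.
    have t3 : (3 <= totient m)%N by apply: totient_ge3; rewrite ?inE; lia.
    apply: lt_le_trans (low 0%N 3 _ _) => //.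
      by apply: lt_le_trans (cge _ _ _ t3).
    by rewrite expn0 /=; nia.
  have s18 : 18 <= lucV s (3 ^ b).
    apply: le_trans (lucV_le s3 (_ : 3 <= 3 ^ b)%N);
      last by rewrite -[3%N]/(3 ^ 1)%N leq_exp2l.
    by rewrite /=; nia.
  apply: lt_le_trans (low b 10 _ _) => //.
    by apply: lt_le_trans (cge _ _ _ t0).
  by move: (lucV s (3 ^ b)) s18 {sb} => v /=; nia.
have V5 v : 3 <= v -> lucV v 5 - 2 = (v - 2) * (v ^+ 2 + v - 1) ^+ 2
  by move=> _ /=; ring.
have [b0|b0] := posnP b.
  (* At s = 3, V_5 - 2 = 121 falls short of 26 . 5, so c = 24 is used with exponent at least 2, as 5
     m > 12 gives m > 2. *)
  move: nE low {sb lE}; rewrite b0 => nE low.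
  have t2 : (2 <= totient m)%N by apply: totient_ge2; lia.
  apply: lt_le_trans (low 0%N 24 _ _) => //.
    by apply: lt_le_trans (cge _ _ _ t2).
  rewrite expn0 [lucV s 1]/= V5 //.
  have : 11 * (s ^+ 2 + s - 1) <= (s ^+ 2 + s - 1) ^+ 2 by nia.
  by nia.
have s18 : 18 <= lucV s (5 ^ b).
  apply: le_trans (lucV_le s3 (_ : 3 <= 5 ^ b)%N).
    by rewrite /=; nia.
  by apply: leq_trans (_ : 5 ^ 1 <= _)%N => //; rewrite leq_exp2l.
apply: lt_le_trans (low b 26 _ _) => //.
  by apply: lt_le_trans (cge _ _ _ t0).
rewrite V5 //; move: (lucV s (5 ^ b)) s18 {sb} => v v18.
have : 26 * (v + 2) <= (v ^+ 2 + v - 1) ^+ 2 by nia.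
by nia.
Qed.

(** * Primitive prime divisors *)

Lemma rank_exists (s : int) p : prime p -> exists a, is_rank s p a.
Proof. by move=> /(lucV_rank_exists s)[a [a0 aP _]]; exists a. Qed.

Lemma rank_dvd_pm1 s p a : prime p -> is_rank s p a ->
  (a %| p.-1)%N || (a %| p.+1)%N.
Proof.
move=> pp [a0 aP]; have [b [b0 bP bpm]] := lucV_rank_exists s pp.
suff -> : a = b by [].
by apply/eqP; rewrite eqn_dvd -aP bP dvdnn -bP aP dvdnn.
Qed.

Lemma Psi_dvd_quo (s : int) q n : (1 < q)%N -> (0 < n)%N -> (2 < q * n)%N ->
  3 <= s ->
  forall x, lucV (lucV s n) q - 2 = (lucV s n - 2) * x ->
  ((Psi (q * n)).[s] ^+ 2 %| x)%Z.
Proof.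
move=> q1 n0 m2 s3 x E; have [c] := Psi_sqr_dvd_quo s q1 n0.
rewrite mulnC -lucV_comp E -mulrA mulnC => /(mulfI (lucV_sub2_neq0 s3 n0)) ->.
by rewrite Psi_sqr_gt2 // dvdz_mulr.
Qed.

(** Otherwise p^4 divides (V_n - 2)/(V_(n/p) - 2). For p odd this quotient contains exactly p^2; for
    p = 3, a <= 4 and n > 12 force j > 0, so that 9 divides V_(n/3) - 2. For p = 2 it equals
    V_(n/4)^2, where 8 | n as a <= 3, and V_(n/4) = V_(n/8)^2 - 2 is never divisible by 4. *)
Lemma Psi_not_sqr_dvd (s : int) p a j n : prime p -> 3 <= s -> is_rank s p a ->
  n = (a * p ^ j.+1)%N -> (12 < n)%N -> ~~ (p%:Z ^+ 2 %| (Psi n).[s])%Z.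
Proof.
move=> pp s3 ra nE n12; have [a0 aP] := ra; apply/negP => h.
have p0 := prime_gt0 pp.
have k0 : (0 < a * p ^ j)%N by rewrite muln_gt0 a0 expn_gt0 p0.
have nE' : n = (p * (a * p ^ j))%N by rewrite nE expnS mulnCA.
have quo := Psi_dvd_quo (prime_gt1 pp) k0; rewrite -nE' in quo.
have n2 : (2 < n)%N by lia.
have {}quo := quo s n2 s3.
have h4 : (p%:Z ^+ 4 %| (Psi n).[s] ^+ 2)%Z by rewrite (exprM _ 2 2) dvdz_exp2r.
have pw : (p%:Z %| lucV s (a * p ^ j) - 2)%Z by rewrite aP dvdn_mulr.
have [p2|p2] := ltnP 2 p.
  have hw : (4 < p)%N || (p%:Z ^+ 2 %| lucV s (a * p ^ j) - 2)%Z.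
    have [//|p4] /= := ltnP 4 p.
    have p3 : p = 3.
      by case: p pp p2 p4 {ra aP nE h p0 k0 nE' quo h4 pw} => [|[|[|[|[|]]]]].
    subst p; case: j nE k0 nE' quo pw => [|j] nE k0 nE' quo pw.
      have := rank_dvd_pm1 pp ra; rewrite /= => /orP[]/dvdn_leq; lia.
    have k0' : (0 < a * 3 ^ j)%N by rewrite muln_gt0 a0 expn_gt0.
    have [z] := lucV_sub2_factor (lucV s (a * 3 ^ j)) 3.
    have H : (3%:Z %| lucV s (a * 3 ^ j) - 2)%Z by rewrite aP dvdn_mulr.
    rewrite lucV_comp -mulnA -expnSr => ->; rewrite expr2 dvdz_mul //.
    by rewrite (dvdzDl_iff _ (dvdz_mulr z H)) dvdz_mulr.
  have [u uE pu] := lucV_prime_val pp p2 pw hw; rewrite subrK in uE.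
  have := dvdz_trans h4 (quo _ uE).
  rewrite -[4%N]/(2 + 2)%N exprD dvdz_mul2l; last by rewrite expf_neq0 // -lt0n.
  by move=> /(dvdz_trans (dvdz_mulr _ (dvdzz p))); rewrite (negPf pu).
have {p2} p2 : p = 2 by apply/eqP; rewrite eqn_leq p2 prime_gt1.
subst p.
have a3 : (a <= 3)%N by have := rank_dvd_pm1 pp ra;
  rewrite /= => /orP[]/dvdn_leq; lia.
case: j nE k0 nE' quo pw => [|[|j]] nE k0 nE' quo pw; [lia | lia |].
have E : lucV (lucV s (a * 2 ^ j.+2)) 2 - 2 = (lucV s (a * 2 ^ j.+2) - 2) *
     (lucV s (a * 2 ^ j.+1)) ^+ 2.
  have -> : lucV s (a * 2 ^ j.+2) = lucV (lucV s (a * 2 ^ j.+1)) 2.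
    by rewrite lucV_comp expnSr mulnA.
  by rewrite /=; ring.
have := dvdz_trans h4 (quo _ E).
rewrite (exprM _ 2 2) dvdzE !(abszX 2) dvdn_pexp2r // => h16.
have : (4 %| lucV s (a * 2 ^ j.+1))%Z by rewrite dvdzE; exact: h16.
have -> : lucV s (a * 2 ^ j.+1) = lucV (lucV s (a * 2 ^ j)) 2.
  by rewrite lucV_comp expnSr mulnA.
move: (lucV s (a * 2 ^ j)) => v /= /dvdzP[c] vE.
have [w [vw|vw]] : exists w, v = 2 * w \/ v = 2 * w + 1 by exists (v %/ 2)%Z;
  lia.
  by move: vE; rewrite vw; lia.
by move: vE; rewrite vw; lia.
Qed.

(** q^(j+1) divides a, and a <= p + 1 <= q, so j = 0 and q = p + 1; hence p = 2 and q = 3. Then b <=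
    4, and the common index 3 b is at most 12. *)
Lemma rank_prime_unique (s : int) p q a b i j : prime p -> prime q ->
  (p < q)%N ->
  is_rank s p a -> is_rank s q b ->
  (a * p ^ i.+1 = b * q ^ j.+1)%N -> (a * p ^ i.+1 <= 12)%N.
Proof.
move=> pp pq ltpq ra rb E; have [a0 _] := ra; have [b0 _] := rb.
have ale : (a <= p.+1)%N.
  have := rank_dvd_pm1 pp ra; have := prime_gt1 pp => p1.
  by move=> /orP[]/dvdn_leq; lia.
have cqp k : coprime (q ^ k) (p ^ i.+1).
  by rewrite coprimeXl // coprimeXr // prime_coprime // dvdn_prime2 // gtn_eqF.
have qa : (q ^ j.+1 %| a)%N by rewrite -(Gauss_dvdl _ (cqp _)) E dvdn_mull.
have qle := dvdn_leq a0 qa.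
have q2 : (q ^ j.+1 < q ^ 2)%N.
  apply: leq_ltn_trans qle _; apply: leq_ltn_trans ale _.
  by move: (prime_gt1 pq); nia.
have j0 : j = 0%N by move: q2; rewrite ltn_exp2l ?prime_gt1 //; lia.
rewrite {}j0 expn1 in E qle qa.
have qE : q = p.+1 by lia.
have p2 : p = 2.
  have := prime_oddPn pp; have := prime_oddPn pq; rewrite qE /=.
  case: (odd p) => /= h1 h2; first by have := h1 isT; move: (prime_gt1 pp); lia.
  by apply: h2.
rewrite E; have := rank_dvd_pm1 pq rb; rewrite qE p2 /= => /orP[]/dvdn_leq; lia.
Qed.

Lemma primitive_prime (s : int) n : 3 <= s -> (12 < n)%N ->
  exists2 p, prime p & is_rank s p n.
Proof.
move=> s3 n12; apply: contrapT => nex.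
have n0 : (0 < n)%N by lia.
have n2 : (2 < n)%N by lia.
have N0 := Psi_gt0 n2 s3.
have div p : prime p -> (p%:Z %| (Psi n).[s])%Z ->
    exists a j, is_rank s p a /\ n = (a * p ^ j.+1)%N.
  move=> pp h; have [a ra] := rank_exists s pp.
  have : (p%:Z %| (Psi_sqr n).[s])%Z by rewrite Psi_sqr_gt2 // dvdz_mulr.
  move=> /(rank_Psi_sqr pp s3 ra n0)[[|j] nE]; last by exists a, j.
  by case: nex; exists p => //; rewrite nE muln1.
have uniq p q : prime p -> prime q -> (p%:Z %| (Psi n).[s])%Z ->
    (q%:Z %| (Psi n).[s])%Z -> p = q.
  move=> pp pq hp hq; have [a [i [ra nE]]] := div p pp hp.
  have [b [j [rb nE']]] := div q pq hq.
  have E : (a * p ^ i.+1 = b * q ^ j.+1)%N by rewrite -nE.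
  case: (ltngtP p q) => // pq'.
    by have := rank_prime_unique pp pq pq' ra rb E; rewrite -nE leqNgt n12.
  by have := rank_prime_unique pq pp pq' rb ra (esym E);
    rewrite -nE' leqNgt n12.
pose N := `|(Psi n).[s]|%N.
have NE : (Psi n).[s] = N%:Z by rewrite gtz0_abs.
have [N1|N1] := leqP N 1.
  have {N1} N1 : N = 1%N by move: N0; rewrite NE; lia.
  (* The largest prime divisor is 2 only if n is a power of 2, and then n > 12 gives 8 | n, as
     [Psi_sqr_gt_prime] demands. *)
  pose p := max_pdiv n.
  have pp : prime p by rewrite max_pdiv_prime //; lia.
  have : p%:Z ^+ 2 < (Psi_sqr n).[s].
    apply: Psi_sqr_gt_prime; rewrite ?max_pdiv_dvd //.
    have [//|p2] /= := ltnP 2 p.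
    have /p_natP[k nE] : (2%N).-nat n.
      apply/pnatP => // q pq qn; rewrite inE /= eqn_leq prime_gt1 // andbT.
      by apply: leq_trans p2; apply: max_pdiv_max; rewrite mem_primes pq n0.
    have k4 : (3 < k)%N.
      by rewrite -(ltn_exp2l 3 k (isT : 1 < 2)%N) -nE; apply: leq_ltn_trans n12.
    by rewrite nE -[8%N]/(2 ^ 3)%N dvdn_exp2l // ltnW.
  rewrite Psi_sqr_gt2 // NE N1; have := prime_gt0 pp; nia.
pose p := pdiv N; have pp : prime p by rewrite pdiv_prime.
have pN : (p %| N)%N by rewrite pdiv_dvd.
have pPsi : (p%:Z %| (Psi n).[s])%Z by rewrite NE dvdzE.
have [a [j [ra nE]]] := div p pp pPsi.
have nsq := Psi_not_sqr_dvd pp s3 ra nE n12.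
have NpE : N = p.
  have /dvdnP[M ME] := pN; have M0 : (0 < M)%N by move: N1; rewrite ME;
    case: M {ME}.
  have [M1|M1] := leqP M 1; first by rewrite ME (_ : M = 1%N) ?mul1n //; lia.
  have qM := pdiv_dvd M; have pq := pdiv_prime M1.
  have qE : p = pdiv M.
    by apply: uniq => //; rewrite NE dvdzE ME /= dvdn_mulr.
  case/negP: nsq; rewrite NE ME expr2 PoszM dvdz_mul //.
  by rewrite dvdzE qE.
have : p%:Z ^+ 2 < (Psi_sqr n).[s].
  apply: Psi_sqr_gt_prime => //; first by rewrite nE expnS mulnCA dvdn_mulr.
  have [//|p2] /= := ltnP 2 p.
  have {}p2 : p = 2 by apply/eqP; rewrite eqn_leq p2 prime_gt1.
  have a3 : (a <= 3)%N.
    by have := rank_dvd_pm1 pp ra; rewrite p2 /= => /orP[]/dvdn_leq; lia.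
  rewrite nE p2; apply: dvdn_mull; rewrite -[8%N]/(2 ^ 3)%N dvdn_exp2l //.
  move: nE n12; rewrite p2; case: j => [|[|j]] // -> ; rewrite ?expn1; nia.
by rewrite Psi_sqr_gt2 // NE NpE ltxx.
Qed.

(** * Pell equation *)

Lemma squarefree_logn D p : squarefree D -> prime p -> (logn p D <= 1)%N.
Proof.
move=> sqD pp; rewrite leqNgt; apply/negP => h.
have := sqD p (dvdn_trans (dvdn_exp2l p h) (pfactor_dvdnn p D)).
by move=> p1; rewrite p1 in pp.
Qed.

Lemma squarefree_mul_sqr D X Y : (1 < D)%N -> squarefree D ->
  (X ^ 2 = D * Y ^ 2)%N -> X = 0%N.
Proof.
move=> D1 sqD E; have [//|X0] := posnP X; have [Y0|Y0] := posnP Y.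
  by move: E; rewrite Y0; lia.
have pp := pdiv_prime D1; set p := pdiv D in pp.
have D0 : (0 < D)%N by lia.
have := congr1 (logn p) E; rewrite lognX lognM ?expn_gt0 ?Y0 // lognX.
have := squarefree_logn sqD pp; have : (0 < logn p D)%N.
  by rewrite logn_gt0 mem_primes pp D0 pdiv_dvd.
lia.
Qed.

Lemma pigeonhole (T : finType) (f : nat ->
  T) : exists i j, (i < j)%N /\ f i = f j.
Proof.
apply: contrapT => h.
have /leq_card : injective (fun i : 'I_#|T|.+1 => f i).
  move=> i j E; apply: val_inj; case: (ltngtP i j) => // ij.
    by case: h; exists i, j.
  by case: h; exists j, i.
by rewrite card_ord ltnn.
Qed.

Section Pell.
Variable D : nat.
Hypotheses (D1 : (1 < D)%N) (sqD : squarefree D).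
Implicit Types m : (int * int) * (int * int).

Definition pell_form (x y : int) : int := x ^+ 2 - D%:Z * y ^+ 2.

Lemma pell_form_neq0 x y : x != 0 -> pell_form x y != 0.
Proof.
move=> x0; apply/eqP => /subr0_eq E.
have : (`|x| ^ 2 = D * `|y| ^ 2)%N by rewrite -!abszX E abszM.
by move/(squarefree_mul_sqr D1 sqD)/eqP; rewrite absz_eq0 (negPf x0).
Qed.

(* Climbing along Conway's river of [x ^+ 2 - D * y ^+ 2]: the two columns of
   the matrix have values of opposite sign, and one of them is replaced by
   their sum. *)
Definition river_step m : (int * int) * (int * int) :=
  let: ((p, r), (q, s)) := m in
  if 0 < pell_form (p + q) (r + s) then ((p + q, r + s), (q, s))
  else ((p, r), (p + q, r + s)).

Definition river n := iter n river_step ((1, 0), (0, 1)).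

(** The coefficients (a, h, b) of the form a X^2 + h X Y + b Y^2 into which the matrix m transforms
    x^2 - D y^2. Its discriminant h^2 - 4 a b remains 4D. *)
Definition river_coef m : int * int * int :=
  let: ((p, r), (q, s)) := m in
  (pell_form p r, 2 * (p * q - D%:Z * (r * s)), pell_form q s).

Definition river_inv m := let: ((p, r), (q, s)) := m in
  [/\ p * s - q * r = 1, 0 < pell_form p r, pell_form q s < 0 &
      [/\ 1 <= p, 0 <= q, 0 <= r & 0 <= s]].

Lemma river_stepP m : river_inv m -> river_inv (river_step m).
Proof.
case: m => [[p r] [q s]] /= [dt a0 b0 [p1 q0 r0 s0]].
have := pell_form_neq0 (r + s) (_ : p + q != 0).
case: ltrgtP => h hn; split=> //.
- by rewrite -dt; ring.
- by split=> //; lia.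
- by rewrite -dt; ring.
- by split=> //; lia.
- by have := hn ltac:(lia).
- by have := hn ltac:(lia).
- by split=> //; lia.
Qed.

Lemma riverP n : river_inv (river n).
Proof.
elim: n => [|n IH]; last exact: river_stepP.
by rewrite /river /= /pell_form; split=> //; lia.
Qed.

(** The step can be undone: the new form takes at the difference of its columns the old a > 0 or the
    old b < 0, and this sign tells which column was replaced. *)
Lemma river_step_inj m m' : river_inv m -> river_inv m' ->
  river_coef (river_step m) = river_coef (river_step m') ->
  river_coef m = river_coef m'.
Proof.
case: m m' => [[p r] [q s]] [[p' r'] [q' s']] /= [dt a0 b0 [p1 q0 r0 s0]].
move=> [dt' a0' b0' [p1' q0' r0' s0']].
have E x y z t : pell_form (x + z) (y + t) =
    pell_form x y + 2 * (x * z - D%:Z * (y * t)) + pell_form z t.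
  by rewrite /pell_form; ring.
have E1 x y z t : 2 * ((x + z) * z - D%:Z * ((y + t) * t)) =
    2 * (x * z - D%:Z * (y * t)) + 2 * pell_form z t.
  by rewrite /pell_form; ring.
have E2 x y z t : 2 * (x * (x + z) - D%:Z * (y * (y + t))) =
    2 * (x * z - D%:Z * (y * t)) + 2 * pell_form x y.
  by rewrite /pell_form; ring.
case: ltrP => h; case: ltrP => h' /=;
  rewrite ?E1 ?E2 ?E in h h' * => -[e1 e2 e3];
  by repeat congr pair; lia.
Qed.

(** h^2 - 4 a b = 4D with a b < 0 is a sum of two nonnegative terms, which bounds all three
    coefficients. *)
Lemma river_bound m : river_inv m -> let: (a, h, b) := river_coef m in
  [/\ 0 < a <= D%:Z, - D%:Z <= b < 0 & - 2 * D%:Z <= h <= 2 * D%:Z].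
Proof.
case: m => [[p r] [q s]] /= [dt a0 b0 _].
have : (2 * (p * q - D%:Z * (r * s))) ^+ 2 - 4 * (pell_form p r * pell_form q
  s) =
    4 * D%:Z * (p * s - q * r) ^+ 2 by rewrite /pell_form; ring.
rewrite dt expr1n mulr1; move: (2 * _) (pell_form _ _) (pell_form _ _) a0 b0.
move=> h a b a0 b0 E; have D1' : 1 < D%:Z by lia.
move: (D%:Z) D1' E => d d1 E; have h2 : 0 <= h ^+ 2 by rewrite sqr_ge0.
split; first by rewrite a0 /=; nia.
  by rewrite b0 andbT; nia.
by apply/andP; split; nia.
Qed.

(** Bounded coefficients must repeat, and by [river_step_inj] a repetition can be moved back to the
    start. *)
Lemma river_periodic : exists2 n, (0 < n)%N & river_coef (river n) =
  river_coef (river 0).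
Proof.
pose code n : 'I_D.+1 * 'I_(4 * D).+1 * 'I_D.+1 :=
  let: (a, h, b) := river_coef (river n) in
  (inord `|a|, inord `|h + 2 * D%:Z|, inord `|b|).
have [i [j [ij E]]] := pigeonhole code.
have {E} E : river_coef (river i) = river_coef (river j).
  move: E; rewrite /code; have := river_bound (riverP i).
  have := river_bound (riverP j); case: (river_coef _) => [[a h] b].
  case: (river_coef _) => [[a' h'] b'] [/andP[? ?] /andP[? ?] /andP[? ?]].
  move=> [/andP[? ?] /andP[? ?] /andP[? ?]] [].
  move=> /(congr1 val) /= e1 /(congr1 val) /= e2 /(congr1 val) /= e3.
  rewrite !inordK in e1 e2 e3; try lia.
  by repeat congr pair; lia.
exists (j - i)%N; first by rewrite subn_gt0.
elim: i j ij E => [|i IH] j ij E; first by rewrite subn0.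
case: j ij E => // j; rewrite ltnS subSS => ij E; apply: IH => //.
by apply: river_step_inj E; apply: riverP.
Qed.

(** A return to the initial form (1, 0, -D) makes the first column (p, r) a solution. It is
    nontrivial: the first step replaces the second column since 1 - D < 0, so q >= 1 from then on,
    and p q = D r s excludes r = 0. *)
Lemma pell_solution : exists x y : nat, (0 < y)%N /\ (x ^ 2 = D * y ^ 2 + 1)%N.
Proof.
have [n n0] := river_periodic.
have : 1 <= (river n).2.1.
  elim: n n0 => // -[_ _|n IH _].
    rewrite /river /= /pell_form /=.
    by have -> : (0 < (1 + 0 : int) ^+ 2 - D%:Z * (0 + 1) ^+ 2) = false by lia.
  move: (riverP n.+1) (IH isT).
  have -> : river n.+2 = river_step (river n.+1) by [].
  case: (river n.+1) => [[p r] [q s]] /= [_ _ _ [p1 q0 r0 s0]] q1.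
  by case: ifP => _ /=; lia.
have := riverP n; case: (river n) => [[p r] [q s]] /= [dt a0 b0 [p1 q0 r0 s0]]
  q1.
rewrite /pell_form => -[E1 E2 _].
exists `|p|%N, `|r|%N; split.
  rewrite absz_gt0; apply/eqP => r0'; move: E2; rewrite r0'; nia.
have [[a aE] [b bE]] : (exists a : nat, p = a%:Z) /\ (exists b : nat, r = b%:Z).
  by split; [exists `|p|%N | exists `|r|%N]; rewrite gez0_abs //; lia.
by move: E1; rewrite aE bE !absz_nat !expr2 -!mulnn !mul0r mulr0 subr0; lia.
Qed.

End Pell.

(** * Units of real quadratic fields *)

Lemma rat_sqr_int (x : rat) (c : int) : x ^+ 2 = c%:~R ->
  exists w : int, x = w%:~R.
Proof.
move=> E; suff : (ratr x : algC) \in Num.int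
  by rewrite Cint_rat => /intrP[w ->]; exists w.
apply: Cint_rat_Aint (Crat_rat x) _.
apply: (@root_monic_Aint (pZtoC ('X^2 - c%:P))).
- rewrite rmorphB /= map_polyXn map_polyC rootE !hornerE -rmorphXn /= E.
  by rewrite rmorph_int subrr.
- exact/monic_map/monicXnsubC.
by apply/polyOverP => i; rewrite coef_map /= intr_int.
Qed.

Lemma Aint_quadratic (x : algC) (T N : int) :
  x ^+ 2 - T%:~R * x + N%:~R = 0 -> x \in Aint.
Proof.
move=> E; apply: (@root_monic_Aint (pZtoC ('X^2 - (T%:P * 'X - N%:P)))).
- rewrite rmorphB /= map_polyXn rmorphB rmorphM /= !map_polyC map_polyX rootE
  !hornerE.
  by rewrite -[X in _ == X]E; apply/eqP; ring.
- apply: monic_map; rewrite monicE lead_coefDl ?lead_coefXn // size_polyN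
  size_polyXn ltnS.
  rewrite (leq_trans (size_polyD _ _)) // geq_max size_polyN.
  rewrite (leq_trans (size_polyC_leq1 _)) // andbT.
  rewrite (leq_trans (size_polyMleq _ _)) // size_polyX addn2 /=.
  by rewrite ltnS size_polyC_leq1.
by apply/polyOverP => i; rewrite coef_map /= intr_int.
Qed.

Section Quadratic.
Variable D : nat.
Hypotheses (D1 : (1 < D)%N) (sqD : squarefree D).
Local Notation rt := (sqrtC D%:R : algC).
Local Notation cj := (quad_conj D).

Lemma rt_sqr : rt * rt = D%:R. Proof. by rewrite -expr2 sqrtCK. Qed.

Lemma rt_gt1 : 1 < rt.
Proof. by rewrite -[ltLHS]sqrtC1 ltr_sqrtC ?nnegrE ?ler01 ?ler0n // (ltr_nat _
  1). Qed.

Lemma rt_gt0 : 0 < rt. Proof. exact: lt_trans ltr01 rt_gt1. Qed.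

Lemma rat_mul_sqr (x y : rat) : x ^+ 2 = D%:R * y ^+ 2 -> x = 0.
Proof.
move=> E; have : (`|(numq x * denq y)%R| ^ 2 = D * `|(numq y * denq x)%R| ^
  2)%N.
  have dx := denq_neq0 x; have dy := denq_neq0 y.
  apply/eqP; rewrite -!abszX -[D]/(`|D%:Z|%N) -abszM; apply/eqP; congr absz.
  apply: (intr_inj (R := rat));
    rewrite rmorphXn rmorphM [in RHS]rmorphM rmorphXn rmorphM /=.
  have nx : x * (denq x)%:~R = (numq x)%:~R
    by rewrite -{1}(divq_num_den x) divfK ?intr_eq0.
  have ny : y * (denq y)%:~R = (numq y)%:~R
    by rewrite -{1}(divq_num_den y) divfK ?intr_eq0.
  rewrite -nx -ny; transitivity (x ^+ 2 * (denq x)%:~R ^+ 2 * (denq y)%:~R ^+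
    2); first by ring.
  by rewrite E -pmulrn; ring.
move=> /(squarefree_mul_sqr D1 sqD)/eqP.
by rewrite absz_eq0 mulf_eq0 (negPf (denq_neq0 y)) orbF numq_eq0 => /eqP.
Qed.

Lemma quad_elt_eq0 a b : quad_elt D (a, b) = 0 -> a = 0 /\ b = 0.
Proof.
rewrite /quad_elt /= => E.
have E' : ratr a = ratr (- b) * rt by apply/eqP;
  rewrite rmorphN mulNr -subr_eq0 opprK E.
have : a ^+ 2 = D%:R * (- b) ^+ 2.
  apply: (fmorph_inj (ratr : rat -> algC)).
  by rewrite rmorphXn rmorphM rmorphXn rmorph_nat /= E' exprMn sqrtCK mulrC.
move=> /rat_mul_sqr a0; split=> //; move: E'; rewrite a0 rmorph0 => /eqP.
by rewrite eq_sym mulf_eq0 (gt_eqF rt_gt0) orbF fmorph_eq0 oppr_eq0 => /eqP.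
Qed.

Lemma quad_elt_inj : injective (quad_elt D).
Proof.
move=> [a b] [c d] E; have [] := @quad_elt_eq0 (a - c) (b - d).
  rewrite /quad_elt /= !rmorphB mulrBl; move: E; rewrite /quad_elt /= => E.
  by apply/eqP; rewrite addrACA -opprD E subrr.
by move=> /subr0_eq -> /subr0_eq ->.
Qed.

Lemma quad_conjE a b : cj (quad_elt D (a, b)) = quad_elt D (a, - b).
Proof.
rewrite /quad_conj; set ab := xget _ _.
have : quad_elt D (a, b) = quad_elt D ab.
  by apply: (@xgetPex _ (0, 0) [set ab | quad_elt D (a, b) = quad_elt D
    ab]%classic); exists (a, b).
by move/quad_elt_inj <-.
Qed.

Lemma quad_eltM a b c d : quad_elt D (a, b) * quad_elt D (c, d) =
  quad_elt D (a * c + b * d * D%:R, a * d + b * c).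
Proof.
rewrite /quad_elt /= !rmorphD !rmorphM /= rmorph_nat.
by move: (sqrtC _) rt_sqr => r <-; ring.
Qed.

Lemma quad_eltD a b c d : quad_elt D (a, b) + quad_elt D (c, d) = quad_elt D
  (a + c, b + d).
Proof. by rewrite /quad_elt /= !rmorphD; ring. Qed.

Lemma quad_eltQ a : quad_elt D (a, 0) = ratr a.
Proof. by rewrite /quad_elt /= rmorph0 mul0r addr0. Qed.

Definition inK x := exists a b, x = quad_elt D (a, b).

Lemma inKM x y : inK x -> inK y -> inK (x * y).
Proof. by move=> [a [b ->]] [c [d ->]]; rewrite quad_eltM; eexists;
  eexists. Qed.

Lemma inKD x y : inK x -> inK y -> inK (x + y).
Proof. by move=> [a [b ->]] [c [d ->]]; rewrite quad_eltD; eexists;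
  eexists. Qed.

Lemma inKQ a : inK (ratr a).
Proof. by exists a, 0; rewrite quad_eltQ. Qed.

Lemma inK_int (n : int) : inK n%:~R.
Proof. by rewrite -(rmorph_int (ratr : rat -> algC)); apply: inKQ. Qed.

Lemma inKX x n : inK x -> inK (x ^+ n).
Proof.
by move=> xK; elim: n => [|n IH]; rewrite ?expr0 ?exprS;
  [apply: (inK_int 1)|apply: inKM].
Qed.

Lemma cjM x y : inK x -> inK y -> cj (x * y) = cj x * cj y.
Proof.
move=> [a [b ->]] [c [d ->]]; rewrite quad_eltM !quad_conjE quad_eltM.
by congr quad_elt; congr pair; ring.
Qed.

Lemma cjD x y : inK x -> inK y -> cj (x + y) = cj x + cj y.
Proof.
move=> [a [b ->]] [c [d ->]]; rewrite quad_eltD !quad_conjE quad_eltD.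
by congr quad_elt; congr pair; ring.
Qed.

Lemma cjQ a : cj (ratr a) = ratr a.
Proof. by rewrite -quad_eltQ quad_conjE oppr0. Qed.

Lemma cj_int (n : int) : cj n%:~R = n%:~R.
Proof. by rewrite -(rmorph_int (ratr : rat -> algC)) cjQ. Qed.

Lemma cjK x : inK x -> cj (cj x) = x.
Proof. by move=> [a [b ->]]; rewrite !quad_conjE opprK. Qed.

Lemma inK_cj x : inK x -> inK (cj x).
Proof. by move=> [a [b ->]]; rewrite quad_conjE; exists a, (- b). Qed.

Lemma cjX x n : inK x -> cj (x ^+ n) = cj x ^+ n.
Proof.
move=> xK; elim: n => [|n IH]; first by rewrite !expr0 (cj_int 1).
by rewrite !exprS cjM ?IH //; apply: inKX.
Qed.

Lemma cj_horner (p : {poly rat}) x : inK x ->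
  inK (pQtoC p).[x] /\ cj (pQtoC p).[x] = (pQtoC p).[cj x].
Proof.
move=> xK; elim/poly_ind: p => [|p c [IK IH]].
  by rewrite rmorph0 !horner0; split; [apply: (inK_int 0) | apply: (cj_int 0)].
rewrite rmorphD rmorphM /= map_polyX map_polyC /= !hornerE.
have cK := inKQ c; have pK := inKM IK xK; split; first exact: inKD.
by rewrite cjD // cjM // IH cjQ.
Qed.

Lemma quad_intP x : reflect (inK x /\ x \in Aint) (x \in quad_int D).
Proof.
apply: (iffP andP) => [[/asboolP[[a b] xE] xA]|[[a [b xE]] xA]].
  by split=> //; exists a, b.
by split=> //; apply/asboolP; exists (a, b).
Qed.

Lemma quad_int_cj x : x \in quad_int D -> cj x \in quad_int D.
Proof.
move=> /quad_intP[xK xA]; apply/quad_intP; split; first exact: inK_cj.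
apply: (@root_monic_Aint (minCpoly x)) (minCpoly_monic x) xA.
have [p [pE _] _] := minCpolyP x; have [_ h] := cj_horner p xK.
rewrite pE rootE -h -pE; have := root_minCpoly x; rewrite rootE => /eqP ->.
by rewrite (cj_int 0).
Qed.

Lemma quad_int_Crat x : x \in quad_int D -> x \in Crat ->
  exists n : int, x = n%:~R.
Proof. by move=> /quad_intP[_ xA] xQ; apply/intrP; apply: Cint_rat_Aint. Qed.

Lemma inK_tr_Crat x : inK x -> x + cj x \in Crat /\ x * cj x \in Crat.
Proof.
move=> [a [b ->]]; rewrite quad_conjE quad_eltD quad_eltM subrr.
rewrite (_ : a * - b + b * a = 0); last by ring.
by rewrite !quad_eltQ !Crat_rat.
Qed.

Lemma quad_int_tr x : x \in quad_int D -> exists T N : int,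
  x + cj x = T%:~R /\ x * cj x = N%:~R.
Proof.
move=> xO; have cO := quad_int_cj xO; have /quad_intP[xK _] := xO.
have [tQ nQ] := inK_tr_Crat xK.
have [T TE] := quad_int_Crat (rpredD xO cO) tQ.
by have [N NE] := quad_int_Crat (rpredM xO cO) nQ; exists T, N.
Qed.

Lemma quad_int_of_tr x (T N : int) : inK x ->
  x + cj x = T%:~R -> x * cj x = N%:~R -> x \in quad_int D.
Proof.
move=> xK tE nE; apply/quad_intP; split=> //.
by apply: (@Aint_quadratic _ T N); rewrite -tE -nE; ring.
Qed.

Lemma quad_int_int (n : int) : n%:~R \in quad_int D.
Proof. by apply/quad_intP; split; [apply: inK_int | apply: Aint_int]. Qed.

(** For x = a + b sqrt D, the number w = 2 b D is an integer with w^2 = D (T^2 - 4 N). Then p | w,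
    so p^2 divides T^2 - 4 N, and p being odd, p^2 divides N. Thus x/p has integral trace and
    norm. *)
Lemma quad_int_divp p x (T N : int) : prime p -> ~~ (p %| 2 * D)%N ->
  x \in quad_int D -> x + cj x = T%:~R -> x * cj x = N%:~R ->
  (p%:Z %| T)%Z -> (p%:Z %| N)%Z -> x / p%:R \in quad_int D.
Proof.
move=> pp p2D xO tE nE pT pN; have /quad_intP[[a [b xE]] _] := xO.
rewrite Euclid_dvdM // negb_or in p2D; have /andP[p2 pD] := p2D.
have aE : 2 * a = T%:~R.
  apply: (fmorph_inj (ratr : rat -> algC));
    rewrite rmorph_int -tE xE quad_conjE.
  by rewrite quad_eltD subrr quad_eltQ; congr ratr; ring.
have bE : a ^+ 2 - b ^+ 2 * D%:R = N%:~R.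
  apply: (fmorph_inj (ratr : rat -> algC));
    rewrite rmorph_int -nE xE quad_conjE.
  rewrite quad_eltM (_ : a * - b + b * a = 0); last by ring.
  by rewrite quad_eltQ; congr ratr; ring.
have [w wE] : exists w : int, 2 * b * D%:R = w%:~R.
  apply: (@rat_sqr_int _ (D%:Z * (T ^+ 2 - 4 * N))).
  by rewrite rmorphM rmorphB rmorphXn rmorphM /= -aE -bE -pmulrn; ring.
have wE2 : w ^+ 2 = D%:Z * (T ^+ 2 - 4 * N).
  apply: (intr_inj (R := rat)); rewrite rmorphXn /= -wE.
  by rewrite rmorphM rmorphB rmorphXn rmorphM /= -aE -bE -pmulrn; ring.
have /dvdzP[T' TE] := pT; have /dvdzP[N' NE] := pN.
have wE3 : w ^+ 2 = D%:Z * p%:Z * (T' ^+ 2 * p%:Z - 4 * N')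
  by rewrite wE2 TE NE; ring.
have /dvdzP[w' w'E] : (p%:Z %| w)%Z.
  by rewrite -(Euclid_dvdzX w 1 pp) wE3 dvdz_mulr // dvdz_mull.
have p0 : p%:Z != 0 :> int by rewrite eqz_nat -lt0n prime_gt0.
have : w' ^+ 2 * p%:Z = D%:Z * (T' ^+ 2 * p%:Z - 4 * N').
  by apply: (mulfI p0); transitivity (w ^+ 2); [rewrite w'E | rewrite wE3];
    ring.
move=> E; have : (p%:Z %| D%:Z * (T' ^+ 2 * p%:Z - 4 * N'))%Z
  by rewrite -E dvdz_mull.
rewrite Euclid_dvdzM // dvdzE (negPf pD) /= => h.
have : (p%:Z %| 4 * N')%Z.
  have -> : 4 * N' = T' ^+ 2 * p%:Z - (T' ^+ 2 * p%:Z - 4 * N') by ring.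
  by rewrite rpredB // dvdz_mull.
rewrite Euclid_dvdzM // => /orP[|/dvdzP[N'' N''E]].
  rewrite (_ : 4 = 2%:Z ^+ 2) // Euclid_dvdzX // dvdzE /= dvdn_prime2 // =>
    /eqP p2E.
  by rewrite p2E in p2.
have pC : p%:R != 0 :> algC by rewrite pnatr_eq0 -lt0n prime_gt0.
have pinv : p%:R^-1 = ratr (p%:R^-1) :> algC by rewrite fmorphV rmorph_nat.
have xK : inK x by exists a, b.
have pcj : cj (x / p%:R) = cj x / p%:R.
  by rewrite pinv cjM ?cjQ //; apply: inKQ.
apply: (@quad_int_of_tr _ T' N'').
- by rewrite pinv; apply: inKM => //; apply: inKQ.
- by rewrite pcj -mulrDl tE TE rmorphM /= -pmulrn mulfK.
rewrite pcj mulrACA nE NE N''E !rmorphM /= -!pmulrn; field; exact: pC.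
Qed.

Definition qunit x := x \in quad_int D /\ (x * cj x = 1 \/ x * cj x = - 1).

Lemma qunit_inK x : qunit x -> inK x.
Proof. by case=> /quad_intP[]. Qed.

Lemma qunit_neq0 x : qunit x -> x != 0.
Proof.
move=> [_ h]; apply/eqP => x0; move: h; rewrite x0 mul0r => -[] /eqP.
  by rewrite eq_sym oner_eq0.
by rewrite eq_sym oppr_eq0 oner_eq0.
Qed.

Lemma qunitP (u : OK D) : is_ring_unit u <-> qunit (val u).
Proof.
split=> [[v uv]|[uO uN]].
  have uO : val u \in quad_int D by exact: valP u.
  have vO : val v \in quad_int D by exact: valP v.
  have [T [N [_ NE]]] := quad_int_tr uO;
    have [T' [N' [_ NE']]] := quad_int_tr vO.
  have E : val u * val v = 1 by rewrite -(rmorphM (val : OK D ->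
    algC)) uv rmorph1.
  have NN : N * N' = 1.
    apply: (intr_inj (R := algC)); rewrite rmorphM /= -NE -NE' mulrACA -cjM ?E.
    - by rewrite (cj_int 1) mulr1.
    - by case/quad_intP: uO.
    - by case/quad_intP: vO.
  split=> //; rewrite NE.
  have /orP[/eqP ->|/eqP ->] : (N == 1) || (N == -1).
    by have /eqP := congr1 absz NN; rewrite abszM muln_eq1 => /andP[]; lia.
    by left.
  by right; rewrite rmorphN rmorph1.
have cO := quad_int_cj uO; case: uN => uN.
  by exists (OKelt cO); apply: val_inj; rewrite rmorphM rmorph1.
have ncO : - cj (val u) \in quad_int D by rewrite rpredN.
by exists (OKelt ncO); apply: val_inj;
  rewrite rmorphM rmorph1 /= mulrN uN opprK.
Qed.

Lemma qunitM x y : qunit x -> qunit y -> qunit (x * y).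
Proof.
move=> xU yU; have [xO xN] := xU; have [yO yN] := yU; split;
  first exact: rpredM.
rewrite (cjM (qunit_inK xU) (qunit_inK yU)) mulrACA.
by case: xN yN => -> [] ->; rewrite ?mulrNN ?mulrN ?mulNr mulr1;
  [left|right|right|left].
Qed.

Lemma qunitN x : qunit x -> qunit (- x).
Proof.
rewrite -mulN1r; apply: qunitM; split; first exact: (quad_int_int (-1)).
by left; rewrite (cj_int (-1)) mulrNN mulr1.
Qed.

Lemma qunitV x : qunit x -> qunit x^-1.
Proof.
move=> xU; have [xO xN] := xU; have x0 := qunit_neq0 xU.
have cU : qunit (cj x).
  split; first exact: quad_int_cj.
  by rewrite (cjK (qunit_inK xU)) mulrC.
have [h|h] := xN.
  by suff -> : x^-1 = cj x by []; apply: (mulfI x0); rewrite h divff.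
suff -> : x^-1 = - cj x by apply: qunitN.
by apply: (mulfI x0); rewrite mulrN h opprK divff.
Qed.

Lemma inK_real x : inK x -> x \is Num.real.
Proof.
move=> [a [b ->]]; have ratr_real c : (ratr c : algC) \is Num.real
  by apply: Creal_Crat (Crat_rat c).
apply: rpredD; first exact: ratr_real.
by apply: rpredM; [apply: ratr_real | apply: gtr0_real rt_gt0].
Qed.

Lemma qunit_trace x : qunit x -> exists n : nat, x ^+ 2 + x ^- 2 = n%:R.
Proof.
move=> xU; have [xO xN] := xU; have x0 := qunit_neq0 xU.
have [T [N [TE NE]]] := quad_int_tr xO.
have cE : cj x ^+ 2 = x ^- 2.
  have x20 := expf_neq0 2 x0; apply: (mulfI x20); rewrite divff // -exprMn.
  by case: xN => ->; rewrite ?sqrrN expr1n.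
have E : x ^+ 2 + x ^- 2 = (T ^+ 2 - 2 * N)%:~R.
  by rewrite -cE rmorphB rmorphXn rmorphM /= -TE -NE; ring.
have : 0 <= x ^+ 2 + x ^- 2.
  have xr := inK_real (qunit_inK xU).
  by rewrite addr_ge0 // ?invr_ge0 real_exprn_even_ge0.
rewrite E ler0z; move: (T ^+ 2 - 2 * N) => c h; exists (absz c).
by rewrite -{1}(gez0_abs h).
Qed.

Lemma add_inv_lt (x y : algC) : 1 < x -> x < y ->
  x ^+ 2 + x ^- 2 < y ^+ 2 + y ^- 2.
Proof.
move=> x1 xy; have x0 := lt_trans ltr01 x1; have y0 := lt_trans x0 xy.
have XY : x ^+ 2 < y ^+ 2 by rewrite ltrXn2r // ltW.
have X1 : 1 < x ^+ 2 by rewrite exprn_egt1.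
move: (x ^+ 2) (y ^+ 2) XY X1 => X Y XY X1.
have X0 := lt_trans ltr01 X1; have Y0 := lt_trans X0 XY.
rewrite -subr_gt0 (_ : _ - _ = (Y - X) * (1 - (X * Y)^-1)); last first.
  by field; rewrite !gt_eqF.
apply: mulr_gt0; rewrite subr_gt0 // invf_lt1 ?mulr_gt0 //.
by rewrite -[ltLHS]mulr1 ltr_pM // ?ler01 //; exact: lt_trans X1 XY.
Qed.

Lemma qunit_gt1_exists : exists2 u, qunit u & 1 < u.
Proof.
have [x [y [y0 E]]] := pell_solution D1 sqD.
exists (quad_elt D (x%:R, y%:R)).
  have E' : quad_elt D (x%:R, y%:R) * cj (quad_elt D (x%:R, y%:R)) = 1.
    rewrite quad_conjE quad_eltM (_ : x%:R * - y%:R + y%:R * x%:R = 0);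
      last by ring.
    rewrite quad_eltQ -(rmorph1 (ratr : rat -> algC)); congr ratr.
    have := congr1 (fun n => n%:R : rat) E.
    by rewrite natrD natrM !natrX => E'; rewrite -[x%:R * _]/(x%:R ^+ 2) E';
      ring.
  split; last by left.
  apply: (@quad_int_of_tr _ (2 * x%:Z) 1) => //; first by exists x%:R, y%:R.
  rewrite quad_conjE quad_eltD subrr quad_eltQ rmorphD /= !rmorph_nat rmorphM
    /= -pmulrn.
  by ring.
rewrite /quad_elt /= !rmorph_nat.
apply: lt_le_trans rt_gt1 _; apply: le_trans (_ : y%:R * rt <= _).
  by rewrite -[leLHS]mul1r ler_wpM2r ?(ltW rt_gt0) // ler1n.
by rewrite lerDr ler0n.
Qed.

(* [u ^+ 2 + u ^- 2] is an integer for both signs of the norm of u, and it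
   increases with u, so that a minimum exists. *)
Lemma qunit_min : exists u, [/\ qunit u, 1 < u & forall v, qunit v -> 1 < v ->
  u <= v].
Proof.
pose P n := `[< exists u, [/\ qunit u, 1 < u & u ^+ 2 + u ^- 2 = n%:R] >].
have exP : exists n, P n.
  have [u uU u1] := qunit_gt1_exists; have [n nE] := qunit_trace uU.
  by exists n; apply/asboolP; exists u.
have [n /asboolP[u [uU u1 uE]] nmin] := ex_minnP exP.
exists u; split=> // v vU v1.
have ur := inK_real (qunit_inK uU); have vr := inK_real (qunit_inK vU).
rewrite real_leNgt //; apply/negP => vu.
have [m mE] := qunit_trace vU; have := add_inv_lt v1 vu.
rewrite mE uE ltr_nat ltnNge nmin //.
by apply/asboolP; exists v.
Qed.

Lemma expr_unbounded (u x : algC) : 1 < u -> 0 <= x -> exists n, x < u ^+ n.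
Proof.
move=> u1 x0; have d0 : 0 < u - 1 by rewrite subr_gt0.
have bern n : 1 + n%:R * (u - 1) <= u ^+ n.
  elim: n => [|n IH]; first by rewrite mul0r addr0 expr0.
  rewrite exprS; apply: le_trans (ler_wpM2l (ltW (lt_trans ltr01 u1)) IH).
  rewrite -subr_ge0 (_ : _ - _ = n%:R * (u - 1) ^+ 2); last by rewrite -natr1;
    ring.
  by rewrite mulr_ge0 ?ler0n // exprn_ge0 // ltW.
exists (Num.bound (x / (u - 1))); apply: lt_le_trans (bern _).
rewrite -[ltLHS](divfK (negbT (gt_eqF d0))) ltr_wpDl //.
by rewrite ltr_pM2r // archi_boundP // divr_ge0 // ltW.
Qed.

Lemma qunit_pow u : qunit u -> 1 < u -> (forall v, qunit v -> 1 < v ->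
  u <= v) ->
  forall v, qunit v -> 1 <= v -> exists n : nat, v = u ^+ n.
Proof.
move=> uU u1 umin v vU v1; have u0 := lt_trans ltr01 u1.
have [n] := expr_unbounded u1 (le_trans ler01 v1).
elim: n v vU v1 => [|n IH] v vU v1 vn.
  by move: vn; rewrite expr0 => /(le_lt_trans v1); rewrite ltxx.
move: v1; rewrite le_eqVlt => /orP[/eqP <-|v1]; first by exists 0.
have uv := umin v vU v1.
have [||k kE] := IH (v / u) (qunitM vU (qunitV uU)).
- by rewrite ler_pdivlMr // mul1r.
- by rewrite ltr_pdivrMr // -exprSr.
by exists k.+1; rewrite exprSr -kE divfK // gt_eqF.
Qed.

Lemma fundamental_unitP : is_fundamental_unit (fundamental_unit D).
Proof.
apply: (@xgetPex _ 1 [set u | is_fundamental_unit u]%classic).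
have [u [uU u1 umin]] := qunit_min; have [uO _] := uU.
have u0 := lt_trans ltr01 u1.
exists (OKelt uO); split; [exact/qunitP | exact: u1 | move=> v /qunitP vU].
have [w [b [wU w0 vE]]] : exists w (b : bool), [/\ qunit w, 0 < w & val v =
  (-1) ^+ b * w].
  have vr := inK_real (qunit_inK vU); have v0 := qunit_neq0 vU.
  have [vp|vn] := real_ltP (rpred0 _) vr.
    by exists (val v), false; split=> //; rewrite expr0 mul1r.
  exists (- val v), true; split; first exact: qunitN.
    by rewrite oppr_gt0 lt_neqAle v0.
  by rewrite expr1 mulN1r opprK.
exists b; rewrite vE /=.
have [w1|w1] := real_leP (rpred1 _) (inK_real (qunit_inK wU)).
  by have [n ->] := qunit_pow uU u1 umin wU w1; exists n%:Z.
have [|n nE] := qunit_pow uU u1 umin (qunitV wU).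
  by rewrite ltW // invf_gt1.
by exists (- n%:Z); rewrite -exprnN -nE invrK.
Qed.

(** If u has norm -1, then u^n has norm (-1)^n, so the units of norm 1 above 1 are the even powers
    of u, that is the powers of u^2. *)
Lemma eps_spec : let e := val (eps D) in
  [/\ e \in quad_int D, e * cj e = 1, 1 < e &
    forall v, qunit v -> v * cj v = 1 -> 1 < v ->
      exists2 k : nat, (0 < k)%N & v = e ^+ k].
Proof.
have [/qunitP uU u1 umin] := fundamental_unitP.
rewrite /eps /quad_norm; set u := fundamental_unit D in uU u1 umin *.
have u0 : 0 < val u := lt_trans ltr01 u1.
have pow v : qunit v -> 1 < v -> exists2 n : nat, (0 < n)%N & v = val u ^+ n.
  move=> [vO vN] v1; have [|b [[n|n] nE]] := umin (OKelt vO);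
    first exact/qunitP.
  - exists n.
      case: n nE => //= nE; move: v1; rewrite nE expr0z mulr1; case: b {nE}.
        by rewrite expr1 le_gtF // (le_trans (lerN10 _) ler01).
      by rewrite expr0 ltxx.
    case: b nE => /= nE; last by rewrite nE expr0 mul1r.
    by move: v1; rewrite nE expr1 mulN1r le_gtF // (le_trans _ ler01) //
      oppr_le0 exprn_ge0 // ltW.
  - exfalso; move: v1; have : 0 < val u ^+ n.+1 by rewrite exprn_gt0.
    have h : 1 <= val u ^+ n.+1 by rewrite exprn_ege1 // ltW.
    move=> h0; rewrite /= in nE; rewrite nE NegzE -exprnN; apply/negP;
      rewrite le_gtF //; case: b {nE}.
      by rewrite expr1 mulN1r (le_trans _ ler01) // oppr_le0 invr_ge0 ltW.
    by rewrite expr0 mul1r invf_le1 // h.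
have [uO uN] := uU; have uK := qunit_inK uU.
case: eqP => [N1|N1].
  by split=> // v vU _ v1; apply: pow.
have {}uN : val u * cj (val u) = -1 by case: uN.
split.
- by rewrite rmorphXn rpredX.
- by rewrite rmorphXn /= cjX // -exprMn uN sqrrN expr1n.
- by rewrite rmorphXn /= exprn_egt1.
move=> v vU vN v1; have [n n0 nE] := pow v vU v1.
have : ~~ odd n.
  move: vN; rewrite nE cjX // -exprMn uN -signr_odd; case: odd => //= /eqP.
  by rewrite expr1 eq_sym -subr_eq0 opprK paddr_eq0 ?ler01 // oner_eq0.
move=> on; exists n./2; first by move: on n0; case: n {nE} => [|[|n]].
by rewrite rmorphXn /= nE -exprM mul2n; congr (_ ^+ _);
  rewrite -[LHS]odd_double_half (negPf on).
Qed.

End Quadratic.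

(** * Orders and valuations *)

Lemma leastP (P : pred nat) n :
  least P = Some n <-> P n /\ forall k, P k -> (n <= k)%N.
Proof.
rewrite /least; case: pselect => [exP|nP]; last first.
  by split=> // -[Pn _]; case: nP; exists n.
case: ex_minnP => m Pm mmin; split=> [[<-]//|[Pn nmin]].
by congr Some; apply/eqP; rewrite eqn_leq mmin // nmin.
Qed.

Section Traces.
Local Arguments quad_conj : simpl never.
Variable D : nat.
Hypotheses (D1 : (1 < D)%N) (sqD : squarefree D).
Local Notation cj := (quad_conj D).
Local Notation e := (val (eps D) : algC).

Lemma eps_gt0 : 0 < e.
Proof. by have [_ _ e1 _] := eps_spec D1 sqD; apply: lt_trans e1. Qed.

Lemma eps_neq0 : e != 0. Proof. by rewrite gt_eqF ?eps_gt0. Qed.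

Lemma OK_inK (x : OK D) : inK D (val x).
Proof. by have /quad_intP[] : val x \in quad_int D by exact: valP x. Qed.

Lemma eps_inK : inK D e.
Proof. exact: OK_inK. Qed.

Lemma cj_eps k : cj (e ^+ k) = e ^- k.
Proof.
have [_ e1 _ _] := eps_spec D1 sqD; rewrite (cjX D1 sqD _ eps_inK) -exprVn.
by congr (_ ^+ _); apply: (mulfI eps_neq0); rewrite e1 divff ?eps_neq0.
Qed.

Lemma t_intr k : (t D k)%:~R = e ^+ k + e ^- k.
Proof.
rewrite /t /quad_trace rmorphXn /= cj_eps.
have [eO _ _ _] := eps_spec D1 sqD.
have [T [N [TE _]]] := quad_int_tr D1 sqD (rpredX k eO).
by rewrite cj_eps in TE; rewrite TE intrKfloor.
Qed.

Lemma t_lucV k : t D k = lucV (t D 1) k.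
Proof.
apply: (intr_inj (R := algC)); rewrite rmorph_lucV /= !t_intr expr1.
by rewrite lucV_addE ?divff ?eps_neq0 // exprVn.
Qed.

Lemma t1_ge3 : 3 <= t D 1.
Proof.
have [_ _ e1 _] := eps_spec D1 sqD.
suff : 2 < t D 1 by lia.
rewrite -(ltr_int algC) t_intr expr1 -subr_gt0.
have -> : e + e^-1 - 2%:~R = (e - 1) ^+ 2 / e by field; exact: eps_neq0.
by rewrite divr_gt0 ?eps_gt0 // exprn_gt0 // subr_gt0.
Qed.

Lemma t_ge3 k : (0 < k)%N -> 3 <= t D k.
Proof. by move=> k0; rewrite t_lucV lucV_ge3 // t1_ge3. Qed.

Section Order.
Variable p : nat.
Hypotheses (pp : prime p) (p2D : ~~ (p %| 2 * D)%N).

Lemma p_neq0 : p%:R != 0 :> algC.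
Proof. by rewrite pnatr_eq0 -lt0n prime_gt0. Qed.

Lemma valO_pmul (x y : OK D) : val x = p%:R * val y -> x = p%:R * y.
Proof. by move=> E; apply: val_inj; rewrite rmorphM rmorph_nat. Qed.

Lemma OK_divp (x : OK D) (T N : int) : val x + cj (val x) = T%:~R ->
  val x * cj (val x) = N%:~R -> (p%:Z %| T)%Z -> (p%:Z %| N)%Z ->
  exists y : OK D, x = p%:R * y.
Proof.
move=> tE nE pT pN.
have yO := quad_int_divp D1 sqD pp p2D (valP x) tE nE pT pN.
by exists (OKelt yO); apply: valO_pmul; rewrite /= mulrC divfK ?p_neq0.
Qed.

Lemma eps_sub1_tr n : let b := val (eps D ^+ n - 1) in
  b + cj b = (t D n - 2)%:~R /\ b * cj b = (2 - t D n)%:~R.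
Proof.
rewrite rmorphB rmorphXn rmorph1 /=.
have -> : e ^+ n - 1 = e ^+ n + (-1)%:~R by rewrite rmorphN rmorph1.
rewrite (cjD D1 sqD) ?(cj_int D1 sqD) ?cj_eps; first last.
- exact: inK_int.
- by apply: inKX => //; apply: eps_inK.
rewrite !rmorphB /= t_intr; have := expf_neq0 n eps_neq0.
by move: (e ^+ n) => x x0; split; field; exact: x0.
Qed.

(** Trace and norm of eps^n - 1 are t_n - 2 and its opposite, so [OK_divp] applies as soon as p
    divides this single integer. *)
Lemma eps_mod n : (exists y, eps D ^+ n = 1 + p%:R * y) <-> (p%:Z %| t D n -
  2)%Z.
Proof.
have [tE nE] := eps_sub1_tr n; split=> [[y E]|h].
  have [T [N [TE NE]]] := quad_int_tr D1 sqD (valP y).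
  suff -> : t D n - 2 = p%:Z * T by rewrite dvdz_mulr.
  have bE : val (eps D ^+ n - 1) = p%:~R * val y.
    by rewrite E addrC addKr rmorphM rmorph_nat -pmulrn.
  have yK := OK_inK y.
  apply: (intr_inj (R := algC)); rewrite -tE bE (cjM D1 sqD (inK_int _ _) yK).
  by rewrite (cj_int D1 sqD) -mulrDr TE rmorphM.
have [|y yE] := OK_divp tE nE h; first by rewrite -opprB rpredN.
by exists y; rewrite -yE addrC subrK.
Qed.

Lemma ord_eps_rank : is_rank (t D 1) p (ord_eps D p).
Proof.
have [a [a0 aP]] := rank_exists (t D 1) pp.
suff -> : ord_eps D p = a by [].
rewrite /ord_eps /order_mod; set P := fun n => _.
suff -> : least P = Some a by [].
have PE n : P n = (0 < n)%N && (a %| n)%N.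
  rewrite /P -aP -t_lucV; congr (_ && _); apply/asboolP/idP => /eps_mod //.
apply/leastP; rewrite PE a0 dvdnn; split=> // k; rewrite PE => /andP[k0].
exact: dvdn_leq.
Qed.

(** * The valuation at a prime ideal above p *)

Section Ideal.
Variable P : prime_idealr (OK D).
Hypothesis pP : p%:R \in P.

Lemma OK_Pmul (x y : OK D) : y \in P -> x * y \in P.
Proof. exact: idealMr. Qed.

Lemma ideal_int (n : int) : n%:~R \in P -> (p%:Z %| n)%Z.
Proof.
move=> nP; rewrite -[(_ %| _)%Z]negbK; apply/negP => h.
have /eqP g1 : coprimez p%:Z n by rewrite coprimezE /= prime_coprime // -dvdzE.
have [u [v uv]] := Bezoutz p%:Z n; rewrite g1 in uv.
have : (1 : OK D) \in P.
  rewrite -[1]/(1%:~R) -uv rmorphD !rmorphM /= rpredD //; last exact: OK_Pmul.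
  by apply: OK_Pmul; rewrite -pmulrn.
by rewrite idealr1.
Qed.

Definition OK_conj (x : OK D) : OK D := OKelt (quad_int_cj D1 sqD (valP x)).

Lemma OK_tr (x : OK D) : exists T N : int,
  [/\ x + OK_conj x = T%:~R, x * OK_conj x = N%:~R,
      val x + cj (val x) = T%:~R & val x * cj (val x) = N%:~R].
Proof.
have [T [N [TE NE]]] := quad_int_tr D1 sqD (valP x); exists T, N; split=> //.
  by apply: val_inj; rewrite rmorphD rmorph_int.
by apply: val_inj; rewrite rmorphM rmorph_int.
Qed.

(* For P = (p) take th = 1, and otherwise the conjugate of an element of P outside
   (p). It replaces the localization at P: th ^+ n maps P ^ n into (p ^ n). *)
Lemma ideal_uniformizer : exists2 th : OK D, th \notin P &
  forall x, x \in P -> exists y, th * x = p%:R * y.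
Proof.
have [[a aP na]|h] := pselect (exists2 a : OK D, a \in P & ~ exists y, a =
  p%:R * y); last first.
  exists 1; first by rewrite idealr1.
  by move=> x xP; rewrite mul1r; apply: contrapT => nx; apply: h; exists x.
have [T [N [TE NE tE nE]]] := OK_tr a.
have pN : (p%:Z %| N)%Z by apply: ideal_int; rewrite -NE mulrC OK_Pmul.
(* If the conjugate of a were in P, trace and norm of a would be integers in P, hence multiples of
   p, and p would divide a. *)
exists (OK_conj a).
  apply/negP => caP; apply: na; apply: (OK_divp tE nE) => //.
  by apply: ideal_int; rewrite -TE rpredD.
(* Trace and norm of conj(a) x lie in P: the conjugate of this product is conj(x) a, a multiple of
   a. *)
move=> x xP; have [T' [N' [TE' NE' tE' nE']]] := OK_tr (OK_conj a * x).
apply: (OK_divp tE' nE').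
  apply: ideal_int; rewrite -TE' rpredD //; first exact: OK_Pmul.
  have -> : OK_conj (OK_conj a * x) = OK_conj x * a.
    apply: val_inj; rewrite [RHS]rmorphM /= (cjM D1 sqD); last 2 first.
    - exact: OK_inK (OK_conj a).
    - exact: OK_inK.
    by rewrite (cjK D1 sqD (OK_inK a)) mulrC.
  exact: OK_Pmul.
apply: ideal_int; rewrite -NE' mulrC; apply: OK_Pmul; exact: OK_Pmul.
Qed.

Lemma ideal_exp_th th n : (forall x, x \in P -> exists y, th * x = p%:R * y) ->
  forall x, x \in ideal_exp P n -> exists y, th ^+ n * x = p%:R ^+ n * y.
Proof.
move=> thP; elim: n => [|n IH] x; first by exists x.
rewrite /ideal_exp iterS => /asboolP[s [sP ->]].
elim: s sP => [|[a b] s IHs]; first by exists 0; rewrite big_nil !mulr0.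
move=> /= /andP[/andP[aP bP] /IHs[y yE]].
have [a' aE] := thP a aP; have [b' bE] := IH b bP.
exists (a' * b' + y); rewrite big_cons mulrDr yE mulrDr /=; congr (_ + _).
by rewrite !exprS mulrACA aE bE; ring.
Qed.

Lemma ideal_exp_pX n (z : OK D) : p%:R ^+ n * z \in ideal_exp P n.
Proof.
elim: n => [|n IH] //; rewrite /ideal_exp iterS; apply/asboolP.
exists [:: (p%:R, p%:R ^+ n * z)]; rewrite big_seq1 /= pP exprS mulrA;
  split=> //.
by rewrite andbT; exact: IH.
Qed.

Lemma OK_pX_inj n : injective (fun x : OK D => p%:R ^+ n * x).
Proof.
move=> x y /(congr1 val); rewrite !rmorphM rmorphXn rmorph_nat /= => h.
by apply: val_inj; apply: mulfI h; rewrite expf_neq0 // p_neq0.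
Qed.

(** If p^n g were in P^m with m > n, multiplying by th^m and cancelling p^n would put th^m g in P,
    although neither th nor g is there. For n = 1 and g = 1 it gives order 1 for p. *)
Lemma ideal_ord_pX n (g : OK D) : g \notin P -> ideal_ord P (p%:R ^+ n * g) = n.
Proof.
move=> gP; have [th thN thP] := ideal_uniformizer.
have upper m : p%:R ^+ n * g \in ideal_exp P m -> (m <= n)%N.
  move=> /(ideal_exp_th thP)[y yE]; rewrite leqNgt; apply/negP => nm.
  have E : th ^+ m * g = p%:R ^+ (m - n) * y.
    by apply: (@OK_pX_inj n); rewrite mulrCA yE mulrA -exprD subnKC // ltnW.
  have : th ^+ m * g \in P.
    by rewrite E mulrC OK_Pmul // -(prednK (_ : 0 < m - n)%N) ?subn_gt0 //
      exprSr OK_Pmul.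
  rewrite prime_idealrM (negPf gP) orbF => h.
  have : th \in P.
    elim: m h {nm E yE} => [|m IHm]; first by rewrite expr0 idealr1.
    by rewrite exprS prime_idealrM => /orP[].
  by rewrite (negPf thN).
rewrite /ideal_ord; apply: xget_unique.
  apply/andP; split; first exact: ideal_exp_pX.
  by apply/negP => /upper; rewrite ltnn.
move=> m /andP[/upper mn] h; apply/eqP; rewrite eqn_leq mn leqNgt.
apply: contra h => lt_mn; rewrite -(subnKC lt_mn) exprD -mulrA.
exact: ideal_exp_pX.
Qed.

(** Divide by p repeatedly: after j divisions the trace is p^(2v-j) M and the norm -p^(2(v-j)) M,
    both divisible by p while j < v. At j = v the norm is -M, so the remaining factor lies in no
    prime above p. *)
Lemma ideal_val_eps n v M : t D n - 2 = p%:Z ^+ (2 * v) * M ->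
  ~~ (p%:Z %| M)%Z ->
  ideal_val p P (eps D ^+ n - 1) = v%:R.
Proof.
move=> tnE pM; have [TE NE] := eps_sub1_tr n.
have p0 : p%:Z != 0 :> int by rewrite eqz_nat -lt0n prime_gt0.
have pjC j : (p%:Z ^+ j)%:~R != 0 :> algC by rewrite intr_eq0 expf_neq0.
have step j (g : OK D) (T N : int) : eps D ^+ n - 1 = p%:R ^+ j * g ->
  (j <= v)%N ->
    val g + cj (val g) = T%:~R -> val g * cj (val g) = N%:~R ->
    T = p%:Z ^+ (2 * v - j) * M /\ N = - (p%:Z ^+ (2 * (v - j)) * M).
  move=> gE jv tg ng.
  have vE : val (eps D ^+ n - 1) = (p%:Z ^+ j)%:~R * val g.
    by rewrite gE rmorphM rmorphXn rmorph_nat /= rmorphXn /= -pmulrn.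
  have cE : cj (val (eps D ^+ n - 1)) = (p%:Z ^+ j)%:~R * cj (val g).
    by rewrite vE (cjM D1 sqD (inK_int _ _) (OK_inK g)) (cj_int D1 sqD).
  rewrite cE vE -mulrDr tg mulrACA ng -?rmorphM in TE NE.
  have {TE} TE := intr_inj TE; have {NE} NE := intr_inj NE.
  split.
    apply: (mulfI (expf_neq0 j p0)); rewrite TE mulrA -exprD subnKC //.
    by apply: leq_trans jv _; rewrite leq_pmull.
  apply: (mulfI (expf_neq0 (2 * j) p0));
    rewrite mul2n -addnn exprD NE -opprB tnE.
  by rewrite mulrN mulrA -!exprD addnn -mul2n -mulnDr subnKC.
have [g gE] : exists g, eps D ^+ n - 1 = p%:R ^+ v * g.
  suff /(_ v (leqnn v)) : forall j, (j <= v)%N ->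
    exists g, eps D ^+ n - 1 = p%:R ^+ j * g by [].
  elim=> [|j IH] jv; first by exists (eps D ^+ n - 1); rewrite expr0 mul1r.
  have [g gE] := IH (ltnW jv).
  have [T [N [_ _ tg ng]]] := OK_tr g.
  have [Tv Nv] := step j g T N gE (ltnW jv) tg ng.
  have pX k : (0 < k)%N -> (p%:Z %| p%:Z ^+ k * M)%Z.
    by case: k => // k _; rewrite exprS -mulrA dvdz_mulr.
  have [||y yE] := OK_divp tg ng.
  - by rewrite Tv pX //; lia.
  - by rewrite Nv rpredN pX //; lia.
  by exists y; rewrite gE yE exprSr mulrA.
have gP : g \notin P.
  have [T [N [_ gN tg ng]]] := OK_tr g.
  have [_ Nv] := step v g T N gE (leqnn v) tg ng.
  apply/negP => gP; case/negP: pM; apply: ideal_int.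
  have -> : M = - N by rewrite Nv subnn muln0 expr0 mul1r opprK.
  by rewrite rmorphN /= -gN rpredN mulrC OK_Pmul.
rewrite /ideal_val gE ideal_ord_pX //.
have -> : p%:R = p%:R ^+ 1 * 1 :> OK D by rewrite mulr1.
by rewrite ideal_ord_pX ?idealr1 // divr1.
Qed.

End Ideal.
End Order.
End Traces.

(** * Values of Psi at the traces *)

Lemma squarefree_mul_eq D D' w : (0 < D)%N -> (0 < D')%N -> squarefree D ->
  squarefree D' -> (w ^ 2 = D * D')%N -> D = D'.
Proof.
move=> D0 D0' sD sD' E; apply: eqn_from_log => // p.
have [pp|pp] := boolP (prime p); last by rewrite /= lognE [RHS]lognE (negPf pp).
have := congr1 (logn p) E; rewrite lognX lognM //.
by have := squarefree_logn sD pp; have := squarefree_logn sD' pp; lia.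
Qed.

Lemma squarefree_part M : (0 < M)%N ->
  exists D f, squarefree D /\ M = (D * f ^ 2)%N.
Proof.
elim/ltn_ind: M => M IH M0;
  have [sq|/existsNP[q /not_implyP[/dvdnP[M' ME] q1]]] := pselect (squarefree
  M).
  by exists M, 1%N; rewrite exp1n muln1.
have [M'0 q0] : (0 < M')%N /\ (0 < q ^ 2)%N.
  by apply/andP; rewrite -muln_gt0 -ME.
have [||D [f [sD E]]] := IH M' => //.
  have q2 : (1 < q)%N by move: q1 q0; case: q {ME} => [|[|]].
  by rewrite ME; nia.
by exists D, (f * q)%N; split; rewrite // expnMn mulnA -E.
Qed.

Section Discriminant.
Variable D : nat.
Hypotheses (D1 : (1 < D)%N) (sqD : squarefree D).

(** With eps^k = a + b sqrt D of norm 1, t_k = 2 a and y = 2 b. So t_k determines D up to rational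
    squares. *)
Lemma t_disc k : exists y : rat, ((t D k) ^+ 2 - 4)%:~R = D%:R * y ^+ 2.
Proof.
have [a [b E]] := inKX k (eps_inK D).
have E' : val (eps D) ^- k = quad_elt D (a, - b)
  by rewrite -cj_eps // E quad_conjE.
exists (2 * b); apply: (fmorph_inj (ratr : rat -> algC)).
rewrite rmorph_int rmorphB rmorphXn /= t_intr // E' E.
rewrite rmorphM rmorphXn rmorphM !rmorph_nat /= /quad_elt /= rmorphN.
have xx : (ratr a + ratr b * sqrtC D%:R) * (ratr a - ratr b * sqrtC D%:R) = 1
  :> algC.
  have := E'; rewrite E /quad_elt /= rmorphN mulNr => <-; rewrite divff //.
  by have := expf_neq0 k (eps_neq0 D1 sqD); rewrite E.
transitivity ((ratr a + ratr b * sqrtC D%:R + (ratr a - ratr b * sqrtC D%:R))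
  ^+ 2 -
  4 * ((ratr a + ratr b * sqrtC D%:R) * (ratr a - ratr b * sqrtC D%:R)) : algC).
  by rewrite xx mulr1 mulNr.
by move: (sqrtC _) (rt_sqr D) => r <-; ring.
Qed.

(** Multiplying by D turns the rational y into an integer w = D y with w^2 = D (t_k^2 - 4); p
    divides w, but D only once. *)
Lemma dvdn_t_disc p k : prime p -> (p %| D)%N -> (p%:Z %| (t D k) ^+ 2 - 4)%Z.
Proof.
move=> pp pD; have [y yE] := t_disc k; move: ((t D k) ^+ 2 - 4) yE => c yE.
have [w wE] : exists w : int, D%:R * y = w%:~R.
  by apply: (@rat_sqr_int _ (D%:Z * c)); rewrite rmorphM /= yE -pmulrn; ring.
have wE2 : w ^+ 2 = D%:Z * c.
  by apply: (intr_inj (R := rat));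
    rewrite rmorphXn /= -wE rmorphM /= yE -pmulrn; ring.
have /dvdzP[w' w'E] : (p%:Z %| w)%Z
  by rewrite -(Euclid_dvdzX w 1 pp) wE2 dvdz_mulr.
have /dvdnP[D' D'E] := pD.
have pD' : ~~ (p %| D')%N.
  apply/negP => /dvdnP[D'' D''E]; have := sqD (q := p).
  rewrite D'E D''E -mulnA mulnn dvdn_mull // => /(_ isT) p1.
  by rewrite p1 in pp.
have p0 : p%:Z != 0 :> int by rewrite eqz_nat -lt0n prime_gt0.
have E : w' ^+ 2 * p%:Z = D'%:Z * c.
  apply: (mulfI p0); transitivity (w ^+ 2); first by rewrite w'E; ring.
  by rewrite wE2 D'E PoszM; ring.
have : (p%:Z %| D'%:Z * c)%Z by rewrite -E dvdz_mull.
by rewrite Euclid_dvdzM // dvdzE (negPf pD').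
Qed.

End Discriminant.

(** D y^2 = D' y'^2 makes D D' the square of a rational, hence of an integer, and both factors are
    square-free. Equality of the exponents then follows from strict growth. *)
Lemma t_inj D D' k k' : (1 < D)%N -> squarefree D -> (0 < k)%N ->
  (1 < D')%N -> squarefree D' -> (0 < k')%N -> t D k = t D' k' ->
    D = D' /\ k = k'.
Proof.
move=> D1 sD k0 D1' sD' k0' E.
have [y yE] := t_disc D1 sD k; have [y' yE'] := t_disc D1' sD' k'.
have t3 := t_ge3 D1 sD k0; rewrite -E in yE';
  move: (t D k) t3 yE yE' => N N3 yE yE'.
have N4 : (N ^+ 2 - 4)%:~R != 0 :> rat by rewrite intr_eq0; nia.
have y0' : y' != 0.
  by apply: contraNneq N4 => y0; rewrite yE' y0 expr0n mulr0.
have yy : D%:R * y ^+ 2 = D'%:R * y' ^+ 2 by rewrite -yE -yE'.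
have [w wE] : exists w : int, D%:R * y / y' = w%:~R.
  apply: (@rat_sqr_int _ (D%:Z * D'%:Z)); rewrite rmorphM /= -!pmulrn.
  transitivity (D%:R * (D%:R * y ^+ 2) / y' ^+ 2); first by field.
  by rewrite yy; field.
have DD : D = D'.
  apply: (@squarefree_mul_eq _ _ `|w|) => //; try exact: ltnW.
  rewrite -abszX -[(D * D')%N]/(`|(D * D')%N%:Z|%N); congr absz.
  apply: (intr_inj (R := rat));
    rewrite rmorphXn /= -wE PoszM rmorphM /= -!pmulrn.
  transitivity (D%:R * (D%:R * y ^+ 2) / y' ^+ 2); first by field.
  by rewrite yy; field.
split=> //; subst D'; case: (ltngtP k k') => // kk; move: E;
  rewrite t_lucV // [RHS]t_lucV //.
  by have := lucV_lt (t1_ge3 D1 sD) kk; lia.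
by have := lucV_lt (t1_ge3 D1 sD) kk; lia.
Qed.

Lemma t_surj (N : int) : 3 <= N -> exists D k,
  [/\ (1 < D)%N, squarefree D, (0 < k)%N & t D k = N].
Proof.
move=> N3; have [n nE] : exists n : nat, N = n%:Z by exists `|N|%N; lia.
subst N; have n3 : (2 < n)%N by lia.
have [|D [f [sD ME]]] := @squarefree_part (n ^ 2 - 4); first by nia.
have f0 : (0 < f)%N by case: f ME => // ; nia.
(* D = 1 would make n^2 - 4 a square, which is impossible for n >= 3. *)
have D1 : (1 < D)%N.
  rewrite ltnNge; apply/negP => D1.
  have : D = 0%N \/ D = 1%N by lia.
  rewrite -!mulnn in ME; case=> DE; rewrite DE in ME; first by nia.
  by have [h|h] := leqP n f; nia.
pose x := quad_elt D (n%:R / 2, f%:R / 2).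
have xK : inK D x by exists (n%:R / 2), (f%:R / 2).
have ncE : x * quad_conj D x = 1.
  rewrite /x quad_conjE // quad_eltM (_ : _ * - _ + _ = 0); last by ring.
  rewrite quad_eltQ -(rmorph1 (ratr : rat -> algC)); congr ratr.
  have -> : n%:R / 2 * (n%:R / 2) + f%:R / 2 * - (f%:R / 2) * D%:R =
     (n%:R ^+ 2 - D%:R * f%:R ^+ 2) / 4 :> rat by field.
  have := congr1 (fun k => k%:R : rat) ME; rewrite natrB; last by nia.
  by rewrite natrM !natrX => <-; field.
have tcE : x + quad_conj D x = n%:~R.
  rewrite /x quad_conjE // quad_eltD subrr quad_eltQ -pmulrn -(rmorph_nat
    (ratr : rat -> algC)).
  by congr ratr; field.
have xO : x \in quad_int D by apply: (@quad_int_of_tr _ x n 1).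
have x1 : 1 < x.
  rewrite /x /quad_elt /=; apply: lt_le_trans (_ : ratr (n%:R / 2) <= _).
    rewrite rmorphM fmorphV !rmorph_nat /= ltr_pdivlMr ?ltr0n // mul1r ltr_nat
      //.
  by rewrite lerDl mulr_ge0 ?ler0q ?divr_ge0 ?ler0n // ltW // rt_gt0.
have [_ _ _ pow] := eps_spec D1 sD.
have [|k k0 kE] := pow x _ ncE x1; first by split=> //; left.
exists D, k; split=> //; apply: (intr_inj (R := algC));
  rewrite t_intr // -kE -tcE.
congr (_ + _); have x0 : x != 0 by rewrite gt_eqF // (lt_trans ltr01).
by apply: (mulfI x0); rewrite divff.
Qed.

(** * The set of values *)

Lemma t_bij : set_bij Dk_pairs [set N : int | 3 <= N]%classic (fun Dk => t
  Dk.1 Dk.2).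
Proof.
split.
- by move=> [D k] [/= D1 sD k0]; apply: t_ge3.
- move=> [D k] [D' k']; rewrite !inE => -[/= D1 sD k0] [/= D1' sD' k0'] E.
  by have [-> ->] := t_inj D1 sD k0 D1' sD' k0' E.
move=> N /= /t_surj[D [k [D1 sD k0 <-]]].
by exists (D, k).
Qed.

Lemma Psi_t_inj m : (2 < m)%N ->
  set_inj Dk_pairs (fun Dk => (Psi m).[t Dk.1 Dk.2]).
Proof.
move=> m2 Dk Dk' hD hD' E; have [tf ti _] := t_bij.
have t3 : 3 <= t Dk.1 Dk.2 by apply: tf; rewrite inE in hD.
have t3' : 3 <= t Dk'.1 Dk'.2 by apply: tf; rewrite inE in hD'.
apply: ti => //=; apply/eqP;
  case: (ltrgtP (t Dk.1 Dk.2) (t Dk'.1 Dk'.2)) => // h.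
  by have := Psi_lt m2 (_ : 2 <= t Dk.1 Dk.2) h;
    rewrite /= E ltxx => /(_ ltac:(lia)).
by have := Psi_lt m2 (_ : 2 <= t Dk'.1 Dk'.2) h;
  rewrite /= E ltxx => /(_ ltac:(lia)).
Qed.

(** If Psi_m is not linear, [Psi_gap] leaves Psi_m(3) + 1 uncovered; if it is X + c, surjectivity of
    t is enough. *)
Lemma Psi_image_full m : (2 < m)%N ->
  ([set N : int | ((Psi m).[3] <= N)%R] `<=`
    (fun Dk => (Psi m).[t Dk.1 Dk.2]) @` Dk_pairs)%classic <-> m \in [:: 3; 4;
      6]%N.
Proof.
move=> m2; have [tf _ ts] := t_bij; split=> [full|mS N /= hN].
  apply: contraT => mN; have := Psi_gap m2 mN;
    case: (full ((Psi m).[3] + 1)) => /=.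
    by rewrite lerDl.
  move=> Dk /tf /= t3 E; move: E t3; move: (t _ _) => s E s3 gap.
  have [s4|s4] : s = 3 \/ 4 <= s by lia.
    by move/eqP: E; rewrite s4 -[eqbLHS]addr0 (inj_eq (addrI _)).
  have : (Psi m).[4] <= (Psi m).[s].
    by move: s4; rewrite le_eqVlt => /orP[/eqP <-|/(Psi_lt m2)/ltW]; last exact.
  by rewrite E; lia.
have [c cE] := Psi_linear mS; rewrite cE in hN.
have [|Dk hD /= tE] := ts (N - c); first by rewrite /=; lia.
by exists Dk; rewrite //= cE tE subrK.
Qed.

Lemma Psi_image_infinite m : (2 < m)%N ->
  infinite_set ((fun Dk => (Psi m).[t Dk.1 Dk.2]) @` Dk_pairs)%classic.
Proof.
move=> m2 fin; have [_ _ ts] := t_bij.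
pose g (n : nat) := (Psi m).[n%:Z + 3].
have gi : injective g.
  move=> a b E; case: (ltngtP a b) => // h.
    have := @Psi_lt m (a%:Z + 3) (b%:Z + 3) m2; rewrite -/(g a) -/(g b) E ltxx.
    by move=> /(_ ltac:(lia) ltac:(lia)).
  have := @Psi_lt m (b%:Z + 3) (a%:Z + 3) m2; rewrite -/(g a) -/(g b) E ltxx.
  by move=> /(_ ltac:(lia) ltac:(lia)).
apply: infinite_nat; apply: sub_finite_set (finite_preimage (f := g) _ fin);
  last first.
  by move=> a b _ _; apply: gi.
move=> n _ /=; have [|Dk hD /= tE] := ts (n%:Z + 3); first by rewrite /=; lia.
by exists Dk; rewrite //= tE.
Qed.

Lemma nat_sqrt N : exists r, (r ^ 2 <= N < r.+1 ^ 2)%N.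
Proof.
elim: N => [|N [r /andP[h1 h2]]]; first by exists 0%N.
have [h|h] := ltnP N.+1 (r.+1 ^ 2); first by exists r; rewrite h (leq_trans h1).
by exists r.+1; rewrite h /=; nia.
Qed.

(** Psi_m has degree at least 2, so Psi_m(s) >= (s - 2)^2 and at most sqrt N values lie in [1, N].
    Their proportion is below e once N > 1/e^2. *)
Lemma Psi_image_density m : (2 < m)%N -> m \notin [:: 3; 4; 6]%N ->
  has_density ((fun Dk => (Psi m).[t Dk.1 Dk.2]) @` Dk_pairs)%classic 0.
Proof.
move=> m2 mN e e0; have [tf _ _] := t_bij; set S := image _ _.
have cnt N : (count (fun i => `[< S i%:Z >]) (iota 1 N) ^ 2 <= N)%N.
  have [r /andP[r1 r2]] := nat_sqrt N; apply: leq_trans r1;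
    rewrite leq_exp2r //.
  rewrite -size_filter -[leqRHS](size_iota 1).
  rewrite -[leqRHS](size_map (fun j : nat => `|(Psi m).[j%:Z + 2]|%N)).
  apply: uniq_leq_size; first exact/filter_uniq/iota_uniq.
  move=> i; rewrite mem_filter mem_iota => /andP[/asboolP[Dk /tf /= t3 tE]
    /andP[i0 iN]].
  have t2 : 2 <= t Dk.1 Dk.2 by apply: le_trans t3.
  have := Psi_ge m2 t2; move: (t _ _) t3 {t2} tE => s s3 sE.
  have [j jE] : exists j : nat, s = j%:Z + 2 by exists `|(s - 2)%R|%N; lia.
  rewrite jE in sE s3 *; rewrite addrK sE => h.
  apply/mapP; exists j; last by rewrite sE.
  have j1 : 1 <= j%:Z by lia.
  have : j%:Z ^+ 2 <= i%:Z by apply: le_trans h; apply: ler_weXn2l => //;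
    apply: Psi_deg_gt1.
  rewrite mem_iota add1n; move: j1 r2 iN i0; rewrite -mulnn expr2 => *.
  by apply/andP; split; nia.
exists (Num.bound (e ^- 2)) => N hN N0; rewrite subr0.
move: (cnt N); set c := count _ _ => cN.
have n0 : 0 < N%:R :> rat by rewrite ltr0n.
rewrite ger0_norm ?divr_ge0 ?ler0n // ltr_pdivrMr // ltNge; apply/negP => h.
have h1 : (c%:R : rat) ^+ 2 <= N%:R by rewrite -natrX ler_nat.
have h2 : e ^- 2 < N%:R.
  apply: lt_le_trans (archi_boundP _) _;
    first by rewrite invr_ge0 exprn_ge0 // ltW.
  by rewrite ler_nat.
have h3 : 1 < e ^+ 2 * N%:R.
  by move: h2; rewrite -[e ^- 2]mul1r ltr_pdivrMr ?exprn_gt0 // mulrC.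
have h4 : (e * N%:R) ^+ 2 <= (c%:R : rat) ^+ 2.
  by rewrite ler_sqr ?nnegrE ?ler0n // mulr_ge0 ?ler0n // ltW.
have : e ^+ 2 * N%:R * N%:R <= 1 * N%:R.
  by rewrite mul1r; apply: le_trans h1; apply: le_trans h4; rewrite le_eqVlt;
    apply/orP; left; apply/eqP; ring.
by rewrite ler_pM2r // leNgt h3.
Qed.

(** * Product formula, ranks and valuations *)

Lemma t_mul_prod D n k : (1 < D)%N -> squarefree D -> (0 < n)%N ->
  t D (n * k) - 2 =
    (t D k - 2) * (t D k + 2) ^+ (2 %| n)%N *
    \prod_(m <- divisors n | (3 <= m)%N) (Psi m).[t D k] ^+ 2.
Proof.
move=> D1 sD n0; rewrite mulnC t_lucV // -lucV_comp -(t_lucV D1 sD).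
move: (t D k) => s; rewrite prod_Psi_sqr // (bigID (fun m => 2 < m)%N) /= mulrC.
congr (_ * _); last by apply: eq_bigr => m m2; rewrite Psi_sqr_gt2.
rewrite big_mkcond (bigD1_seq 1%N) ?divisors_uniq //=; last first.
  by rewrite -dvdn_divisors // dvd1n.
congr (_ * _); first by rewrite /Psi_sqr /= !hornerE.
have F2 : (Psi_sqr 2).[s] = s + 2 by rewrite /Psi_sqr /= !hornerE.
have [d2|d2] := boolP (2 %| n)%N.
  rewrite -big_filter (bigD1_seq 2%N) ?filter_uniq ?divisors_uniq //=;
    last first.
    by rewrite mem_filter -dvdn_divisors.
  rewrite F2 expr1 -[RHS]mulr1; congr (_ * _); apply: big1_seq => i.
  rewrite mem_filter -dvdn_divisors // => /andP[i2 /andP[i1 dn]].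
  by rewrite ifF //; have := dvdn_gt0 n0 dn; lia.
rewrite expr0; apply: big1_seq => i; rewrite -dvdn_divisors // => /andP[i1 dn].
rewrite ifF //; have := dvdn_gt0 n0 dn.
have : i != 2%N by apply: contra d2 => /eqP <-.
lia.
Qed.

Lemma least_ex (P : pred nat) k : P k -> exists n, least P = Some n.
Proof.
move=> Pk; have exP : exists n, P n by exists k.
have [n Pn nmin] := ex_minnP exP; exists n; exact/leastP.
Qed.

(** The left side says that the rank o / gcd(o, k) of p for t_k is m; this solves it for k. *)
Lemma div_gcd_eq o m k : (0 < o)%N -> (0 < k)%N -> (o %/ gcdn o k == m)%N <->
  (m %| o)%N /\ exists l, [/\ (1 <= l)%N, coprime l m & k = (o %/ m * l)%N].
Proof.
move=> o0 k0; have g0 : (0 < gcdn o k)%N by rewrite gcdn_gt0 o0.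
split=> [/eqP mE|[/dvdnP[g oE] [l [l0 co kE]]]].
  have oE : o = (m * gcdn o k)%N by rewrite -mE divnK ?dvdn_gcdl.
  have m0 : (0 < m)%N by move: o0; rewrite oE muln_gt0 => /andP[].
  have kE := divnK (dvdn_gcdr o k).
  split; first by rewrite oE dvdn_mulr.
  exists (k %/ gcdn o k)%N; split.
  - by rewrite divn_gt0 // dvdn_leq // dvdn_gcdr.
  - rewrite /coprime -(eqn_pmul2r g0) muln_gcdl mul1n -oE kE; exact/eqP/gcdnC.
  - by rewrite {1}oE mulKn // mulnC kE.
have m0 : (0 < m)%N by move: o0; rewrite oE muln_gt0 => /andP[].
have g0' : (0 < g)%N by move: o0; rewrite oE muln_gt0 => /andP[].
rewrite kE oE mulnK // -muln_gcdr gcdnC (eqP co) muln1 mulKn //.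
Qed.

Section Rho.
Variables (D m p : nat).
Hypotheses (D1 : (1 < D)%N) (sD : squarefree D) (m2 : (2 < m)%N) (pp : prime p).
Hypothesis pN : ~~ (p %| 2 * m * D)%N.
Let o := ord_eps D p.

Let pm : ~~ (p %| m)%N.
Proof. by apply: contra pN => h; rewrite mulnAC dvdn_mull. Qed.

Let p2D : ~~ (p %| 2 * D)%N.
Proof. by apply: contra pN => h; rewrite mulnAC dvdn_mulr. Qed.

Let ro : is_rank (t D 1) p o := ord_eps_rank D1 sD pp p2D.

Let o0 : (0 < o)%N. Proof. by case: ro. Qed.

Let om_gt0 : (m %| o)%N -> (0 < o %/ m)%N.
Proof. by move=> mo; rewrite divn_gt0 ?(ltnW (ltnW m2)) // dvdn_leq. Qed.

Lemma dvdz_Psi_sqr (s : int) : (p%:Z %| (Psi m).[s])%Z = (p%:Z %| (Psi_sqr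
  m).[s])%Z.
Proof. by rewrite Psi_sqr_gt2 // Euclid_dvdzX. Qed.

Lemma rank_t k : (0 < k)%N -> is_rank (t D k) p (o %/ gcdn o k).
Proof. by move=> k0; rewrite t_lucV //; apply: is_rank_lucV. Qed.

Lemma dvd_Psi_t k : (0 < k)%N -> (p%:Z %| (Psi m).[t D k])%Z <->
  (m %| o)%N /\ exists l, [/\ (1 <= l)%N, coprime l m & k = (o %/ m * l)%N].
Proof.
move=> k0; rewrite dvdz_Psi_sqr (rank_eq_Psi_sqr pp (t_ge3 D1 sD k0) (rank_t
  k0)) //.
  exact: div_gcd_eq.
by lia.
Qed.

Lemma rho_finite : (exists r, rho D m p = Some r) <-> (m %| o)%N.
Proof.
split=> [[r /leastP[/andP[r0 /(dvd_Psi_t r0)[]]]] //|mo].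
have k0 : (0 < o %/ m)%N by apply: om_gt0.
apply: (@least_ex _ (o %/ m)%N); rewrite k0; apply/(dvd_Psi_t k0); split=> //.
by exists 1%N; rewrite coprime1n muln1.
Qed.

Lemma rhoE r : rho D m p = Some r -> r = (o %/ m)%N.
Proof.
move=> rE; have mo : (m %| o)%N by apply/rho_finite; exists r.
move/leastP: rE => [/andP[r0 /(dvd_Psi_t r0)[_ [l [l1 _ rE]]]] rmin].
have k0 : (0 < o %/ m)%N by apply: om_gt0.
apply/eqP; rewrite eqn_leq {2}rE leq_pmulr // andbT; apply: rmin; rewrite k0.
by apply/(dvd_Psi_t k0); split=> //; exists 1%N; rewrite coprime1n muln1.
Qed.

Lemma rank_coprime : ~~ (p %| o)%N.
Proof.
apply/negP => po; have p1 := prime_gt1 pp.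
have := rank_dvd_pm1 pp ro => /orP[] /(dvdn_trans po).
  by move=> /dvdn_leq; lia.
by rewrite -addn1 dvdn_addr // dvdn1 => /eqP p1'; rewrite p1' in p1.
Qed.

(** For k = (o/m) l one has m k = o l, so 2 v_p(Psi_m(t_k)) = v_p(t_(o l) - 2) = v_p(t_o - 2) + 2
    v_p(l). The middle valuation is twice that of Psi_o(t_1), hence at least 2, which lets
    [logn_lucV_mul] apply even for p = 3. *)
Lemma logn_Psi_t l (P : prime_idealr (OK D)) : (m %| o)%N -> (1 <= l)%N ->
  coprime l m ->
  p%:R \in P ->
  (logn p `|(Psi m).[t D (o %/ m * l)]|)%:R =
    ideal_val p P (eps D ^+ o - 1) + (logn p l)%:R.
Proof.
move=> mo l1 co pP; have r0 : (0 < o %/ m)%N by apply: om_gt0.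
have o2 : (2 < o)%N by apply: leq_trans m2 (dvdn_leq o0 mo).
have p2 : (2 < p)%N.
  rewrite ltn_neqAle prime_gt1 // andbT eq_sym; apply: contra p2D => /eqP ->.
  by rewrite dvdn_mulr.
have p0 : p%:Z != 0 by rewrite eqz_nat -lt0n prime_gt0.
have s3 := t1_ge3 D1 sD; have so3 := t_ge3 D1 sD o0.
have w0 : t D o - 2 != 0 by lia.
set v := logn p `|(Psi o).[t D 1]|.
have vE : logn p `|t D o - 2| = (2 * v)%N.
  rewrite (t_lucV D1 sD) (logn_lucV_Psi_sqr pp s3 ro rank_coprime) Psi_sqr_gt2
    //.
  by rewrite abszX lognX.
have Psi_o : (p%:Z %| (Psi o).[t D 1])%Z.
  by have := rank_dvd_Psi_sqr pp ro; rewrite Psi_sqr_gt2 // Euclid_dvdzX.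
have v0 : (0 < v)%N.
  by rewrite logn_gt0 mem_primes pp absz_gt0 gt_eqF ?Psi_gt0.
have /dvdzP[M ME] : (p%:Z ^+ (2 * v) %| t D o - 2)%Z.
  by rewrite dvdzE abszX -vE pfactor_dvdnn.
have pM : ~~ (p%:Z %| M)%Z.
  apply/negP => /dvdzP[M' M'E].
  have : (p ^ (2 * v).+1 %| `|(t D o - 2)%R|)%N.
    by rewrite ME M'E -mulrA -exprS abszM abszX dvdn_mull.
  by rewrite pfactor_dvdn ?absz_gt0 // vE ltnn.
rewrite (ideal_val_eps D1 sD pp p2D pP (v := v) (M := M)) 1?mulrC //.
rewrite -natrD; congr _%:R.
have k0 : (0 < o %/ m * l)%N by rewrite muln_gt0 r0.
have rm : is_rank (t D (o %/ m * l)) p m.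
  have /eqP mE : (o %/ gcdn o (o %/ m * l) == m)%N.
    by apply/div_gcd_eq => //; split=> //; exists l.
  by rewrite -[X in is_rank _ _ X]mE; apply: rank_t.
have := logn_lucV_Psi_sqr pp (t_ge3 D1 sD k0) rm pm.
rewrite Psi_sqr_gt2 // abszX lognX.
have -> : lucV (t D (o %/ m * l)) m = lucV (t D o) l.
  rewrite (t_lucV D1 sD (_ * _)) (t_lucV D1 sD o) !lucV_comp; congr lucV.
  by rewrite mulnAC divnK.
rewrite (logn_lucV_mul pp p2 l1 so3) ?vE; first lia.
apply: (@dvdz_trans (p%:Z ^+ (2 * v))); last by rewrite ME dvdz_mull.
by rewrite dvdz_exp2l //; lia.
Qed.

End Rho.

(** The primitive prime avoids 2D: the rank of 2 is at most 3, and a prime divisor of D divides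
    t_1^2 - 4 = t_2 - 2, so its rank is at most 2. *)
Lemma ord_eps_exists D n : (1 < D)%N -> squarefree D -> (12 < n)%N ->
  exists p, [/\ prime p, ~~ (p %| 2 * D)%N & ord_eps D p = n].
Proof.
move=> D1 sD n12; have [p pp rn] := primitive_prime (t1_ge3 D1 sD) n12.
have [n0 nP] := rn.
have p2D : ~~ (p %| 2 * D)%N.
  rewrite Euclid_dvdM // negb_or dvdn_prime2 //; apply/andP; split.
    apply/eqP => p2; have := rank_dvd_pm1 pp rn.
    by rewrite p2 /= => /orP[] /dvdn_leq; lia.
  apply/negP => pD; have := dvdn_t_disc D1 sD 1 pp pD.
  have -> : t D 1 ^+ 2 - 4 = lucV (t D 1) 2 - 2 by rewrite /=; ring.
  by rewrite nP => /dvdn_leq; lia.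
exists p; split=> //; have [o0 oP] := ord_eps_rank D1 sD pp p2D.
by apply/eqP; rewrite eqn_dvd -oP nP dvdnn -nP oP dvdnn.
Qed.

Local Open Scope classical_set_scope.

Theorem theorem1 :
  (* (i) *)
  (set_bij Dk_pairs [set N : int | 3 <= N] (fun Dk => t Dk.1 Dk.2) /\
   forall m : nat, (3 <= m)%N ->
     let f := fun Dk : nat * nat => (Psi m).[t Dk.1 Dk.2] in
     [/\ set_inj Dk_pairs f,
         [set N : int | (Psi m).[3] <= N] `<=` f @` Dk_pairs
           <-> m \in [:: 3; 4; 6]%N
       & m \notin [:: 3; 4; 6]%N ->
           infinite_set (f @` Dk_pairs) /\ has_density (f @` Dk_pairs) 0]) /\
  (* (ii) *)
  (forall D : nat, (1 < D)%N -> squarefree D ->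
   forall n k : nat, (1 <= n)%N -> (1 <= k)%N ->
     t D (n * k) - 2 =
       (t D k - 2) * (t D k + 2) ^+ (2 %| n)%N *
       \prod_(m <- divisors n | (3 <= m)%N) (Psi m).[t D k] ^+ 2) /\
  (* (iii) *)
  (forall D : nat, (1 < D)%N -> squarefree D ->
   forall m : nat, (3 <= m)%N ->
   forall p : nat, prime p -> ~~ (p %| 2 * m * D)%N ->
     ((exists r, rho D m p = Some r) <-> (m %| ord_eps D p)%N) /\
     forall r : nat, rho D m p = Some r ->
       [/\ r = (ord_eps D p %/ m)%N,
           forall k : nat, (1 <= k)%N ->
             ((p%:Z %| (Psi m).[t D k])%Z <->
              exists l : nat, [/\ (1 <= l)%N, coprime l m & k = (r * l)%N])
         & forall l : nat, (1 <= l)%N -> coprime l m ->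
           forall P : prime_idealr (OK D), p%:R \in P ->
             (logn p `|(Psi m).[t D (r * l)]|)%:R =
               ideal_val p P (eps D ^+ ord_eps D p - 1) + (logn p l)%:R]) /\
  (* (iv) *)
  (forall D : nat, (1 < D)%N -> squarefree D ->
   forall n : nat, (12 < n)%N ->
     exists p : nat, [/\ prime p, ~~ (p %| 2 * D)%N & ord_eps D p = n]).
Proof.
split; first split; first exact: t_bij.
  move=> m m2; split; [exact: Psi_t_inj | exact: Psi_image_full | move=> mN].
  by split; [apply: Psi_image_infinite | apply: Psi_image_density].
split; first by move=> D D1 sD n k n1 _; apply: t_mul_prod.
split; last by move=> D D1 sD n n12; apply: ord_eps_exists.
move=> D D1 sD m m2 p pp pN; split; first exact: rho_finite.
move=> r rE; have rE' := rhoE D1 sD m2 pp pN rE.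
have mo : (m %| ord_eps D p)%N by apply/(rho_finite D1 sD m2 pp pN); exists r.
split=> //.
  move=> k k1; rewrite rE'; split=> [/(dvd_Psi_t D1 sD m2 pp pN k1)[]//|kE].
  by apply/(dvd_Psi_t D1 sD m2 pp pN k1).
by move=> l l1 co P pP; rewrite rE'; apply: logn_Psi_t.
Qed.
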